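(* Let $\mathbf{B}$ be the bowtie poset, with universe $B=\{0,1,2,3\}$ and order given by $0<1$, $0<3$, $2<1$, $2<3$ (and reflexivity); $0$ and $2$ are incomparable, and $1$ and $3$ are incomparable. Then the problem $\textsc{MC}(\{\mathbf{B}\},\mathcal{FO}(\forall,\exists,\wedge))$ is $\mathrm{NP}$-hard.
   Context: $\mathcal{FO}(\forall,\exists,\wedge)$ (conjunctive positive logic) denotes the class of first-order sentences over the vocabulary $\{\le\}$ (one binary relation symbol) that are built from atoms of the form $t\le t'$ and $t=t'$ ($t,t'$ variables) using only the logical symbols $\forall$, $\exists$, $\wedge$. All posets considered are finite and have at least two elements. For a class $\mathcal{C}$ of posets, $\textsc{MC}(\mathcal{C},\mathcal{FO}(\forall,\exists,\wedge))$ is the problem of deciding, given $(\mathbf{P},\phi)$ with $\mathbf{P}\in\mathcal{C}$ and $\phi\in\mathcal{FO}(\forall,\exists,\wedge)$, whether $\mathbf{P}\models\phi$. *)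

(* Defs.v *)
From mathcomp Require Import all_boot.
Set Implicit Arguments. Unset Strict Implicit. Unset Printing Implicit Defensive.

Inductive cpformula : Type :=
| FLe  : nat -> nat -> cpformula
| FEq  : nat -> nat -> cpformula
| FAnd : cpformula -> cpformula -> cpformula
| FAll : nat -> cpformula -> cpformula
| FEx  : nat -> cpformula -> cpformula.

Fixpoint free_in (v : nat) (phi : cpformula) : bool :=
  match phi with
  | FLe i j | FEq i j => (v == i) || (v == j)
  | FAnd p q => free_in v p || free_in v q
  | FAll i p | FEx i p => (v != i) && free_in v p
  end.

Definition sentence (phi : cpformula) : Prop := forall v, free_in v phi = false.

Definition upd (T : Type) (e : nat -> T) (i : nat) (a : T) : nat -> T :=
  fun v => if v == i then a else e v.

Fixpoint sat (T : Type) (le : T -> T -> bool) (e : nat -> T) (phi : cpformula)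
  : Prop :=
  match phi with
  | FLe i j => le (e i) (e j)
  | FEq i j => e i = e j
  | FAnd p q => sat le e p /\ sat le e q
  | FAll i p => forall a : T, sat le (upd e i a) p
  | FEx i p => exists a : T, sat le (upd e i a) p
  end.

Definition bowtie_le (x y : 'I_4) : bool :=
  (x == y) ||
  [|| ((x : nat) == 0) && ((y : nat) == 1),
      ((x : nat) == 0) && ((y : nat) == 3),
      ((x : nat) == 2) && ((y : nat) == 1) |
      ((x : nat) == 2) && ((y : nat) == 3)].

(* P |= phi for a sentence phi (the environment is irrelevant). *)
Definition bowtie_models (phi : cpformula) : Prop :=
  forall e : nat -> 'I_4, sat bowtie_le e phi.

Definition enc_var (n : nat) : seq bool := nseq n true ++ [:: false].

Fixpoint enc_formula (phi : cpformula) : seq bool :=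
  match phi with
  | FLe i j => [:: false; false; false] ++ enc_var i ++ enc_var j
  | FEq i j => [:: false; false; true] ++ enc_var i ++ enc_var j
  | FAnd p q => [:: false; true; false] ++ enc_formula p ++ enc_formula q
  | FAll i p => [:: false; true; true] ++ enc_var i ++ enc_formula p
  | FEx i p => [:: true; false; false] ++ enc_var i ++ enc_formula p
  end.

(* The problem MC({B}, FO(forall,exists,/\)) as a language of bit strings:
   since the class of structures is the single poset B, an instance is
   (an encoding of) a sentence; yes-instances are the sentences true in B.
   Strings not encoding a sentence are no-instances. *)
Definition MC_bowtie (w : seq bool) : Prop :=
  exists phi, w = enc_formula phi /\ sentence phi /\ bowtie_models phi.

Definition Sym := option bool.   (* None = blank *)

Inductive Dir := DL | DR | DS.


Record TM := {
  tm_Q : finType;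
  tm_start : tm_Q;
  tm_halt : pred tm_Q;
  tm_delta : tm_Q -> Sym -> tm_Q * Sym * Dir
}.
Arguments tm_start : clear implicits.
Arguments tm_halt : clear implicits.
Arguments tm_delta : clear implicits.

Record config (Q : Type) := Config {
  c_st : Q; c_left : seq Sym; c_head : Sym; c_right : seq Sym }.

Definition tm_step (M : TM) (c : config (tm_Q M)) : config (tm_Q M) :=
  let: Config q l h r := c in
  if tm_halt M q then c else
  let: (q', a, d) := tm_delta M q h in
  match d with
  | DS => Config q' l a r
  | DL => match l with
          | [::] => Config q' [::] None (a :: r)
          | b :: l' => Config q' l' b (a :: r)
          end
  | DR => match r with
          | [::] => Config q' (a :: l) None [::]
          | b :: r' => Config q' (a :: l) b r'
          end
  end.

Definition tm_init (M : TM) (w : seq bool) : config (tm_Q M) :=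
  Config (tm_start M) [::] (head None (map Some w)) (behead (map Some w)).

Definition tm_run (M : TM) (t : nat) (w : seq bool) : config (tm_Q M) :=
  iter t (@tm_step M) (tm_init M w).

Fixpoint read_bits (s : seq Sym) : seq bool :=
  match s with
  | Some b :: s' => b :: read_bits s'
  | _ => [::]
  end.

Definition tm_output (M : TM) (c : config (tm_Q M)) : seq bool :=
  read_bits (c_head c :: c_right c).

Definition poly_bound (c n : nat) : nat := c * n ^ c + c.

Definition poly_computable (f : seq bool -> seq bool) : Prop :=
  exists (M : TM) (c : nat), forall w : seq bool,
    exists t, t <= poly_bound c (size w) /\
      tm_halt M (c_st (tm_run M t w)) /\ tm_output (tm_run M t w) = f w.

Definition in_P (L : seq bool -> Prop) : Prop :=
  exists f, poly_computable f /\ forall w, L w <-> f w = [:: true].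

Definition pair_enc (w y : seq bool) : seq bool :=
  flatten (map (fun b => [:: b; b]) w) ++ [:: false; true] ++ y.

Definition in_NP (L : seq bool -> Prop) : Prop :=
  exists V, in_P V /\ exists c, forall w,
    L w <-> exists y, size y <= poly_bound c (size w) /\ V (pair_enc w y).

Definition poly_reduces (L1 L2 : seq bool -> Prop) : Prop :=
  exists f, poly_computable f /\ forall w, L1 w <-> L2 (f w).

Definition NP_hard (L : seq bool -> Prop) : Prop :=
  forall L', in_NP L' -> poly_reduces L' L.

(* Main.v *)
From HB Require Import structures.
Require Import Defs.
From mathcomp Require Import all_boot zify.
Set Implicit Arguments. Unset Strict Implicit. Unset Printing Implicit Defensive.

(** In the bowtie, [exists z, a, a' <= z <= b, b'] holds for minimal [a], [a']
    and maximal [b], [b'] exactly when [a = a'] or [b = b']. Universally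
    quantified variables may take the values 0, 2 and 1, 3, which then serve as
    constants; for any other values the constants chosen below and above them
    satisfy every gadget used. A chain of elements leading from the constant 0
    to the constant 2 must change somewhere, which expresses a disjunction of
    conjunctions of literals, hence any finite table of allowed values for a
    bounded number of variables. The tableau of a Turing machine is a family of
    such local constraints, so an NP problem reduces to truth in the bowtie.
    The formula is written down by a word rewriting process in which the first
    letter of a word tells how to rewrite all the others, and such a process is
    carried out by a Turing machine sweeping back and forth over its tape. *)

(** The formula has to be written by an actual one-tape machine, and this shapes the instance. Every
    constraint is a shift of one of finitely many templates: winding the tableau into a single
    sequence turns each transition into the same relation between entries [j], [j + 1], [j + 2] and
    [j + s], with [s] the number of initial squares, so two counters determine a block. Variables
    are coded in unary, hence raising a counter means inserting a fixed string behind a marker,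
    which letterwise rewriting can do. The pass that emits a block raises the counters of the older
    ones, so squares emitted earlier get larger indices; winding the rows from right to left
    therefore lets the input be emitted in reading order. Polynomially many steps, guesses and
    blanks come from letters that carry an exponent, which the input bits expand. The NP certificate
    is a stretch of headless squares of the initial row, constrained only to hold a word followed by
    blanks. *)

(** * Turing machines: tape views *)

(* Identifies tapes that differ only by trailing blanks, so that the end of a
   list behaves like an infinite blank half-tape. *)
Definition tape_view (M : TM) (c : config (tm_Q M)) q (l s : seq Sym) :=
  [/\ c_st c = q, nth None (c_left c) =1 nth None l &
      nth None (c_head c :: c_right c) =1 nth None s].

Lemma nth_behead_eq (T : Type) (d : T) s t :
  nth d s =1 nth d t -> nth d (behead s) =1 nth d (behead t).
Proof. by move=> E i; rewrite !nth_behead. Qed.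

Lemma tape_view_right M (c : config (tm_Q M)) q l s q' b :
  tape_view c q l s -> ~~ tm_halt M q ->
  tm_delta M q (head None s) = (q', b, DR) ->
  tape_view (tm_step c) q' (b :: l) (behead s).
Proof.
case: c => p cl h cr [/= -> El Es] Hq; rewrite /tm_step (negbTE Hq).
have -> : h = head None s by rewrite -nth0 -(Es 0).
move=> ->; have Er i : nth None cr i = nth None (behead s) i.
  by rewrite nth_behead -Es.
case: cr Es Er => [|b' r] Es Er; split=> //= -[|i] //=; rewrite ?nth_nil //;
  by rewrite -Er ?nth_nil.
Qed.

Lemma tape_view_left M (c : config (tm_Q M)) q l s q' b :
  tape_view c q l s -> ~~ tm_halt M q ->
  tm_delta M q (head None s) = (q', b, DL) ->
  tape_view (tm_step c) q' (behead l) (head None l :: b :: behead s).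
Proof.
case: c => p cl h cr [/= -> El Es] Hq; rewrite /tm_step (negbTE Hq).
have -> : h = head None s by rewrite -nth0 -(Es 0).
move=> ->; have Er i : nth None cr i = nth None (behead s) i.
  by rewrite nth_behead -Es.
have Eh := El 0; have Et := nth_behead_eq El.
by case: cl Eh Et {El} => [|b' r] Eh Et; split=> //= -[|[|i]] //=;
  rewrite -?nth0 -?Eh.
Qed.

Lemma tape_view_eq M (c : config (tm_Q M)) q l s l' s' :
  tape_view c q l s -> nth None l =1 nth None l' ->
  nth None s =1 nth None s' -> tape_view c q l' s'.
Proof.
by move=> [E1 E2 E3] E4 E5; split=> // i; rewrite ?E2 ?E3 ?E4 ?E5.
Qed.

Lemma tape_view_init M w :
  tape_view (tm_init M w) (tm_start M) [::] (map Some w).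
Proof. by case: w => [|b w]; split=> // -[|i]; rewrite //= nth_nil. Qed.

Lemma tape_view_output M (c : config (tm_Q M)) q l w :
  tape_view c q l (map Some w) -> tm_output c = w.
Proof.
rewrite /tm_output => -[_ _].
elim: w (_ :: _) => [|b w IH] [|a s] E //=.
- by have /= -> := E 0.
- by have /= := E 0.
by have /= -> := E 0; rewrite IH // => i; apply: (E i.+1).
Qed.

Lemma nth_trail (s : seq Sym) : nth None (s ++ [:: None]) =1 nth None s.
Proof.
move=> i; rewrite nth_cat; case: ltnP => // Hi.
by rewrite [RHS]nth_default //; case: (i - _) => [|[|j]].
Qed.

Lemma tm_run_add M t t' w :
  tm_run M (t + t') w = iter t' (@tm_step M) (tm_run M t w).
Proof. by rewrite /tm_run addnC iterD. Qed.

(** * Pass machines *)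

(* A pass machine consumes a word bit by bit ([rd]) while writing the next
   word; at the end of a pass, [en] either halts or appends a last chunk and
   makes the word written so far the input of the next pass. *)
Section PassMachine.
Variables (K : finType) (k0 : K).
Variables (rd : K -> bool -> K * seq bool) (en : K -> option (K * seq bool)).

Definition pm_step (x : K * seq bool * seq bool) : K * seq bool * seq bool :=
  match x with
  | (k, b :: u, v) => ((rd k b).1, u, v ++ (rd k b).2)
  | (k, [::], v) =>
      match en k with Some (k', o) => (k', v ++ o, [::]) | None => x end
  end.

Definition max_out : nat :=
  maxn (\max_(p : K * bool) size (rd p.1 p.2).2)
       (\max_(k : K) if en k is Some (_, o) then size o else 0).

(** The chunk still to be written is kept in the state; bounding its length keeps the state set
    finite. *)
Definition outbuf : finType := max_out.-bseq bool.

Definition buf (s : seq bool) : outbuf := insub_bseq max_out s.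

Lemma bufE s : size s <= max_out -> buf s = s :> seq bool.
Proof. by move=> Hs; rewrite /buf /insub_bseq insubdK. Qed.

Lemma size_rd k b : size (rd k b).2 <= max_out.
Proof.
apply: leq_trans (leq_maxl _ _).
by apply: (@leq_bigmax _ (fun p : K * bool => size (rd p.1 p.2).2) (k, b)).
Qed.

Lemma size_en k k' o : en k = Some (k', o) -> size o <= max_out.
Proof.
move=> E; apply: leq_trans (leq_maxr _ _).
have := @leq_bigmax _ (fun k : K => if en k is Some (_, o) then size o else 0) k.
by rewrite E.
Qed.

(* [inl k]: about to read; then moving right over the unread word, moving
   right over the written word and appending, moving left over the written
   word, moving left over the unread word, halted. The boolean flags the end
   of a pass. *)
Definition pm_state : finType :=
  (K + (K * outbuf + (K * outbuf * bool + (K * bool + (K + unit)))))%type.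
Notation Pop k := (inl k : pm_state).
Notation OverUnread k o := (inr (inl (k, o)) : pm_state).
Notation Append k o np := (inr (inr (inl (k, o, np))) : pm_state).
Notation BackWritten k np := (inr (inr (inr (inl (k, np)))) : pm_state).
Notation BackUnread k := (inr (inr (inr (inr (inl k)))) : pm_state).
Notation Halted := (inr (inr (inr (inr (inr tt)))) : pm_state).

Definition pm_delta (q : pm_state) (a : Sym) : pm_state * Sym * Dir :=
  match q with
  | inl k =>
      match a with
      | Some b => (OverUnread (rd k b).1 (buf (rd k b).2), None, DR)
      | None => match en k with
                | Some (k', o) => (Append k' (buf o) true, None, DR)
                | None => (Halted, None, DR)
                end
      end
  | inr (inl (k, o)) =>
      if a is Some _ then (q, a, DR) else (Append k o false, None, DR)
  | inr (inr (inl (k, o, np))) =>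
      if a is Some _ then (q, a, DR) else
      if (o : seq bool) is b :: o' then (Append k (buf o') np, Some b, DR)
      else (BackWritten k np, None, DL)
  | inr (inr (inr (inl (k, np)))) =>
      if a is Some _ then (q, a, DL) else
      if np then (Pop k, None, DR) else (BackUnread k, None, DL)
  | inr (inr (inr (inr (inl k)))) =>
      if a is Some _ then (q, a, DL) else (Pop k, None, DR)
  | _ => (q, a, DS)
  end.

Definition pm_tm : TM := {|
  tm_Q := pm_state;
  tm_start := Pop k0;
  tm_halt := fun q => if q is inr (inr (inr (inr (inr _)))) then true else false;
  tm_delta := pm_delta |}.

Notation step := (@tm_step pm_tm).
Notation view := (@tape_view pm_tm).

Lemma sweep_right q (c : config pm_state) l u s :
  view c q l (map Some u ++ s) ->
  (forall b, pm_delta q (Some b) = (q, Some b, DR)) -> ~~ tm_halt pm_tm q ->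
  view (iter (size u) step c) q (catrev (map Some u) l) s.
Proof.
move=> V Hd Hq; elim: u c l V => [|b u IH] c l V //=.
rewrite -iterS iterSr; apply: IH.
exact: (tape_view_right V Hq (Hd b)).
Qed.

Lemma sweep_left q (c : config pm_state) X Y u s :
  X = catrev (map Some u) Y ->
  view c q (behead X) (head None X :: s) ->
  (forall b, pm_delta q (Some b) = (q, Some b, DL)) -> ~~ tm_halt pm_tm q ->
  view (iter (size u) step c) q (behead Y)
    (head None Y :: map Some u ++ s).
Proof.
move=> -> V Hd Hq; elim/last_ind: u c s V => [|u b IH] c s V //=.
rewrite size_rcons iterSr.
move: V; rewrite map_rcons -cats1 catrev_catl /= => V.
have V' := tape_view_left V Hq (Hd b).
rewrite -catA; exact: IH V'.
Qed.

Lemma append_buf k np (o : outbuf) (c : config pm_state) l :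
  view c (Append k o np) l [::] ->
  exists c', c' = iter (size o).+1 step c /\
  view c' (BackWritten k np) (behead (catrev (map Some o) l))
    (head None (catrev (map Some o) l) :: [:: None]).
Proof.
move=> V; eexists; split; first by [].
move Es: (bseqval o) => s; elim: s o Es c l V => [|b s IH] o Es c l V.
  by apply: (tape_view_left V) => //=; rewrite Es.
rewrite [size _]/= iterSr; apply: (IH (buf s)).
  by rewrite bufE //; apply: leq_trans (size_bseq o); rewrite Es.
by apply: (tape_view_right V) => //=; rewrite Es.
Qed.

(** The squares to the left are arbitrary, because the walk back stops at the blank that replaced
    the bit just read. *)
Definition at_pop (c : config pm_state) (x : K * seq bool * seq bool) :=
  let: (k, u, v) := x in
  exists l, view c (Pop k) l (map Some u ++ None :: map Some v).

Lemma write_out k np (c : config pm_state) Y s v : size s <= max_out ->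
  view c (Append k (buf s) np) (None :: Y) (map Some v) ->
  exists m, m <= 2 * (size v + size s) + 1 /\
  view (iter m step c) (BackWritten k np) Y
    (None :: map Some (v ++ s) ++ [:: None]).
Proof.
rewrite -[map Some v]cats0 => Hs V.
have V1 := sweep_right V (fun b => erefl) isT.
have [c' [Ec' V2]] := append_buf V1.
rewrite bufE // in Ec' V2.
have V3 := sweep_left (u := v ++ s) (Y := None :: Y) _ V2 (fun b => erefl) isT.
exists (size (v ++ s) + (size s).+1 + size v); split.
  by rewrite size_cat; move: (size v) (size s) => a b; lia.
by rewrite !iterD -Ec'; apply: V3; rewrite map_cat catrev_catl.
Qed.

Lemma pm_step_sim (c : config pm_state) x (k := x.1.1) (u := x.1.2) (v := x.2) :
  at_pop c x -> ~~ ((u == [::]) && (en k == None)) ->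
  exists m, m <= 2 * (size u + size v + max_out) + 6 /\
            at_pop (iter m step c) (pm_step x).
Proof.
rewrite {}/k {}/u {}/v; case: x => -[k u] v [l V]; case: u V => [|b u] /= V.
  case E: (en k) => [[k' o]|] // _.
  have V1 : view (step c) (Append k' (buf o) true) (None :: l) (map Some v).
    by apply: (tape_view_right V); rewrite //= E.
  have Ho := size_en E.
  have [m [Hm V2]] := write_out Ho V1.
  exists (1 + (m + 1)); split.
    by move: Hm Ho => /=; move: (size v) (size o) max_out => a b d; lia.
  (* The old separator is left behind; the blank after the written word is the separator of the next
     pass. *)
  exists (None :: l); rewrite addnA addn1 iterS addnC iterD /=.
  exact: (tape_view_right V2 isT erefl).
move=> _.
have V1 : view (step c) (OverUnread (rd k b).1 (buf (rd k b).2)) (None :: l)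
    (map Some u ++ None :: map Some v) by apply: (tape_view_right V).
have V2 := sweep_right V1 (fun b => erefl) isT.
have V3 : view (step (iter (size u) step (step c)))
    (Append (rd k b).1 (buf (rd k b).2) false)
    (None :: catrev (map Some u) (None :: l)) (map Some v).
  exact: (tape_view_right V2).
have [m [Hm V4]] := write_out (size_rd k b) V3.
have V5 := tape_view_left V4 isT erefl.
have V6 := sweep_left erefl V5 (fun b => erefl) isT.
have V7 := tape_view_right V6 isT erefl.
have Ho := size_rd k b.
exists (1 + (size u + (1 + (m + (1 + (size u + 1)))))).
split; first by move: Hm Ho => /=; move: (size u) (size v) (size _) max_out => a a' a1 d; lia.
rewrite !iterD.
exists (None :: l); apply: tape_view_eq V7 _ _ => //= i.
by rewrite -[None :: map Some _ ++ _]cat_cons catA nth_trail.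
Qed.


Lemma pm_run_sim n (c : config pm_state) x B : at_pop c x ->
  (forall i, i < n -> let: (k, u, v) := iter i pm_step x in
     ~~ ((u == [::]) && (en k == None)) && (size u + size v <= B)) ->
  exists m, m <= n * (2 * (B + max_out) + 6) /\
            at_pop (iter m step c) (iter n pm_step x).
Proof.
elim: n => [|n IH] Hc Hx; first by exists 0.
have [i /ltnW Hi|m [Hm Hc']] := IH Hc; first exact: Hx.
have := Hx n (leqnn _); case E: (iter n pm_step x) Hc' => [[k u] v] Hc' /andP [Hk HB];
  have [m' [Hm' Hc'']] := pm_step_sim Hc' Hk.
exists (m' + m); rewrite iterD iterS E; split=> //.
rewrite mulSn leq_add // (leq_trans Hm') // leq_add2r leq_mul2l /=.
by rewrite leq_add2r.
Qed.

Lemma pm_computes n w k v B :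
  iter n pm_step (k0, w, [::]) = (k, [::], v) -> en k = None ->
  (forall i, i < n -> let: (k, u, v) := iter i pm_step (k0, w, [::]) in
     ~~ ((u == [::]) && (en k == None)) && (size u + size v <= B)) ->
  exists t, [/\ t <= n * (2 * (B + max_out) + 6) + 1,
    tm_halt pm_tm (c_st (tm_run pm_tm t w)) &
    tm_output (tm_run pm_tm t w) = v].
Proof.
move=> En Ek HB.
have H0 : at_pop (tm_init pm_tm w) (k0, w, [::]).
  exists [::]; apply: tape_view_eq (tape_view_init _ _) _ _ => // i.
  by rewrite nth_trail.
have [m [Hm]] := pm_run_sim H0 HB; rewrite En => -[l V].
(* Stepping off the separator puts the head on the first written bit, where [tm_output] starts
   reading. *)
have V' : view (step (iter m step (tm_init pm_tm w))) Halted (None :: l) (map Some v).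
  by apply: (tape_view_right V); rewrite //= Ek.
exists (m + 1); split; first by rewrite leq_add2r.
  by rewrite tm_run_add; case: V' => /= ->.
by rewrite tm_run_add; apply: tape_view_output V'.
Qed.
End PassMachine.

(** * Polynomial growth *)

(** The base [n.+1] is positive, so powers are monotone in [d], and sums and products are handled by
    adding exponents. *)
Definition polynomial (f : nat -> nat) :=
  exists K d, forall n, f n <= K * n.+1 ^ d.

Lemma polynomial_le f g :
  (forall n, f n <= g n) -> polynomial g -> polynomial f.
Proof. by move=> H [K [d Hg]]; exists K, d => n; apply: leq_trans (Hg n). Qed.

Lemma polynomial_const K : polynomial (fun=> K).
Proof. by exists K, 0 => n; rewrite muln1. Qed.

Lemma polynomial_id : polynomial id.
Proof. by exists 1, 1 => n; rewrite mul1n expn1. Qed.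

Lemma polynomial_add f g :
  polynomial f -> polynomial g -> polynomial (fun n => f n + g n).
Proof.
move=> [K [d Hf]] [K' [d' Hg]]; exists (K + K'), (d + d') => n.
rewrite mulnDl; apply: leq_add.
  by apply: leq_trans (Hf n) _; rewrite leq_mul2l leq_pexp2l ?leq_addr // orbT.
by apply: leq_trans (Hg n) _; rewrite leq_mul2l leq_pexp2l ?leq_addl // orbT.
Qed.

Lemma polynomial_mul f g :
  polynomial f -> polynomial g -> polynomial (fun n => f n * g n).
Proof.
move=> [K [d Hf]] [K' [d' Hg]]; exists (K * K'), (d + d') => n.
by rewrite expnD mulnACA leq_mul.
Qed.

Lemma polynomial_exp f d : polynomial f -> polynomial (fun n => f n ^ d).
Proof.
move=> Hf; elim: d => [|d IH]; first exact: polynomial_const 1.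
apply: polynomial_le (polynomial_mul Hf IH) => n.
by rewrite expnS.
Qed.

Lemma polynomial_bound f :
  polynomial f -> exists c, forall n, f n <= poly_bound c n.
Proof.
(* For [n > 0], [n.+1 ^ d <= 2 ^ d * n ^ d]; the summand [d] makes the exponent large enough, and
   the additive constant of [poly_bound] covers [n = 0]. *)
move=> [K [d Hf]]; exists (K * 2 ^ d + d) => n; apply: leq_trans (Hf n) _.
rewrite /poly_bound; case: n => [|n].
  rewrite exp1n muln1; apply: leq_trans (leq_addl _ _).
  by rewrite (leq_trans _ (leq_addr _ _)) // leq_pmulr ?expn_gt0.
apply: leq_trans (leq_addr _ _).
apply: (@leq_trans (K * 2 ^ d * n.+1 ^ d)).
  rewrite -mulnA -expnMn leq_mul2l; apply/orP; right.
  by elim: d {Hf} => // d IH; rewrite !expnS leq_mul //; lia.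
by rewrite leq_mul ?leq_addr // leq_pexp2l // leq_addl.
Qed.

(** * Word rewriting computed in polynomial time *)

(* One pass removes the first letter of the word, which decides how all the
   other letters are rewritten. *)
Definition rw_step (L : Type) (h : L -> L -> seq L) (w : seq L) : seq L :=
  if w is a :: u then flatten (map (h a) u) else [::].

Section Rewriting.
Variables (L : finType) (h : L -> L -> seq L) (stop : pred L).
Variables (raw : L -> seq bool) (inp : bool -> L) (tail : seq L).

Definition code (a : L) : seq bool := nseq (enum_rank a) true ++ [:: false].
Definition codes (w : seq L) : seq bool := flatten (map code w).

(* The mode is [None] while the raw input is translated, [Some None] before
   the first letter of a word and [Some (Some a)] after the first letter [a];
   the counter holds the part of the current letter read so far. *)
Definition rw_state : finType := (option (option L) * 'I_#|L|.+1)%type.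

Definition on_letter (m : option L) (a : L) : L * seq bool :=
  match m with
  | None => (a, [::])
  | Some s => (s, if stop s then raw a else codes (h s a))
  end.

Definition rw_rd (k : rw_state) (b : bool) : rw_state * seq bool :=
  match k.1 with
  | None => (k, code (inp b))
  | Some m => if b then ((k.1, inord k.2.+1), [::]) else
      let: (s, o) := on_letter m (nth (inp true) (enum L) k.2) in
      ((Some (Some s), ord0), o)
  end.

Definition rw_en (k : rw_state) : option (rw_state * seq bool) :=
  match k.1 with
  | None => Some ((Some None, ord0), codes tail)
  | Some None => None
  | Some (Some s) => if stop s then None else Some ((Some None, ord0), [::])
  end.

Notation step := (pm_step rw_rd rw_en).

Definition good B (x : rw_state * seq bool * seq bool) : bool :=
  let: (k, u, v) := x in
  ~~ ((u == [::]) && (rw_en k == None)) && (size u + size v <= B).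

Definition reach B n x y :=
  iter n step x = y /\ forall i, i < n -> good B (iter i step x).

Lemma reach_trans B n n' x y z :
  reach B n x y -> reach B n' y z -> reach B (n + n') x z.
Proof.
move=> [E H] [E' H']; split; first by rewrite addnC iterD E.
move=> i Hi; case: (ltnP i n) => [/H //|Hn].
by rewrite -(subnK Hn) iterD E H' // ltn_subLR.
Qed.

Lemma reach1 B x : good B x -> reach B 1 x (step x).
Proof. by move=> H; split=> // -[]. Qed.

Lemma read_letter B m a u v j r : r + j = enum_rank a ->
  j.+1 + size u + size v <= B ->
  reach B j.+1 ((Some m, inord r), nseq j true ++ false :: u, v)
    ((Some (Some (on_letter m a).1), ord0), u, v ++ (on_letter m a).2).
Proof.
elim: j r => [|j IH] r Hr HB.
  have Ho : r < #|L|.+1 by rewrite -(addn0 r) Hr ltnS ltnW.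
  rewrite (_ : (_, u, _) = step (Some m, inord r, nseq 0 true ++ false :: u, v)).
    by apply: reach1 => /=.
  rewrite /= /rw_rd /= inordK // -[r]addn0 Hr nth_enum_rank.
  by case: (on_letter m a).
rewrite -addn1 addnC.
apply: reach_trans (IH r.+1 _ _); last first.
- by apply: leq_trans HB; rewrite !addSn.
- by rewrite addSnnS.
have Ho : r < #|L|.+1.
  by rewrite ltnS (leq_trans (leq_addr j.+1 r)) // Hr ltnW.
rewrite (_ : (_, nseq j _ ++ _, _) =
  step (Some m, inord r, nseq j.+1 true ++ false :: u, v)).
  apply: reach1 => /=; apply: leq_trans HB.
  by rewrite size_cat size_nseq /= addnS.
by rewrite /= /rw_rd /= inordK // cats0.
Qed.

Lemma size_code a : size (code a) = (enum_rank a).+1.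
Proof. by rewrite size_cat size_nseq addn1. Qed.

Lemma code_cat a w : code a ++ w = nseq (enum_rank a) true ++ false :: w.
Proof. by rewrite -catA. Qed.

Lemma codes_cons a w : codes (a :: w) = code a ++ codes w.
Proof. by []. Qed.

Lemma codes_cat u v : codes (u ++ v) = codes u ++ codes v.
Proof. by rewrite /codes map_cat flatten_cat. Qed.

Lemma size_codes w : size (codes w) <= #|L| * size w.
Proof.
by elim: w => // a w IH; rewrite codes_cons size_cat mulnS leq_add // size_code.
Qed.

Definition outs s u := flatten (map (fun a => (on_letter (Some s) a).2) u).

Lemma outs_cons s a u : outs s (a :: u) = (on_letter (Some s) a).2 ++ outs s u.
Proof. by []. Qed.

Lemma read_word B s u v :
  size (codes u) + size v + size (outs s u) <= B ->
  reach B (size (codes u)) ((Some (Some s), ord0), codes u, v)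
    ((Some (Some s), ord0), [::], v ++ outs s u).
Proof.
elim: u v => [|a u IH] v HB; first by rewrite cats0.
move: HB; rewrite codes_cons outs_cons catA => HB.
rewrite (size_cat (code a)) (size_cat _ (outs s u)) size_code in HB *.
apply: reach_trans (IH _ _); last first.
  by apply: leq_trans HB; rewrite size_cat -!addnA leq_addl.
rewrite code_cat -[ord0 in X in reach _ _ X _]inord_val.
apply: read_letter => //; apply: leq_trans HB.
exact: leq_addr.
Qed.

Lemma pass_first B s u :
  size (codes (s :: u)) + size (outs s u) <= B ->
  reach B (size (codes (s :: u))) ((Some None, ord0), codes (s :: u), [::])
    ((Some (Some s), ord0), [::], outs s u).
Proof.
rewrite codes_cons (size_cat (code s)) size_code => HB.
apply: reach_trans (read_word (v := [::]) _); last first.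
  by apply: leq_trans HB; rewrite addn0 -addnA leq_addl.
rewrite code_cat -[ord0 in X in reach _ _ X _]inord_val.
apply: (@read_letter B None) => //.
by apply: leq_trans HB; rewrite addn0 leq_addr.
Qed.

Lemma pass_step B s u : ~~ stop s ->
  size (codes (s :: u)) + size (codes (rw_step h (s :: u))) <= B ->
  reach B (size (codes (s :: u)) + 1) ((Some None, ord0), codes (s :: u), [::])
    ((Some None, ord0), codes (rw_step h (s :: u)), [::]).
Proof.
move=> Hs /= HB.
have E : outs s u = codes (flatten (map (h s) u)).
  rewrite /outs /= (negbTE Hs); elim: u {HB} => //= a u ->.
  by rewrite codes_cat.
apply: reach_trans (pass_first _) _; rewrite E //.
rewrite (_ : (_, codes _, _) =
   step (Some (Some s), ord0, [::], codes (flatten (map (h s) u)))).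
  apply: reach1; rewrite /= /rw_en /= (negbTE Hs) /=.
  by apply: leq_trans HB; apply: leq_addl.
by rewrite /= /rw_en /= (negbTE Hs) cats0.
Qed.

Lemma input_pass B w : 
  size w + size (codes (map inp w ++ tail)) <= B ->
  reach B (size w + 1) ((None, ord0), w, [::])
    ((Some None, ord0), codes (map inp w ++ tail), [::]).
Proof.
suff H v : size w + size (v ++ codes (map inp w ++ tail)) <= B ->
  reach B (size w + 1) ((None, ord0), w, v)
    ((Some None, ord0), v ++ codes (map inp w ++ tail), [::]) by apply: (H [::]).
elim: w v => [|b w IH] v HB.
  apply: (@reach1 B (None, ord0, [::], v)) => /=.
  by apply: leq_trans HB; rewrite add0n size_cat leq_addr.
rewrite /= -add1n -addnA.
rewrite /codes /= -/(codes _) catA.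
apply: (@reach_trans _ _ _ _ (None, ord0, w, v ++ code (inp b))).
  apply: (@reach1 B (None, ord0, b :: w, v)) => /=.
  by apply: leq_trans HB; rewrite size_cat addnA leq_addr.
apply: IH; rewrite -catA; apply: leq_trans HB.
by rewrite leq_add2r.
Qed.

(** During a pass the tape holds the rest of the old word and the finished part of the new one,
    hence the budget [B + B]. *)
Lemma iter_passes B k w :
  (forall i, i < k -> exists s u, iter i (rw_step h) w = s :: u /\ ~~ stop s) ->
  (forall i, i <= k -> size (codes (iter i (rw_step h) w)) <= B) ->
  exists2 n, n <= k * B.+1 &
    reach (B + B) n ((Some None, ord0), codes w, [::])
      ((Some None, ord0), codes (iter k (rw_step h) w), [::]).
Proof.
elim: k => [|k IH] Hs HB; first by exists 0.
have [i Hi|i Hi|n Hn R] := IH.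
- by apply: Hs; apply: ltnW.
- by apply: HB; apply: ltnW.
have [s [u [E Es]]] := Hs k (leqnn _).
have Hk := HB k (leqnSn _); have HSk := HB k.+1 (leqnn _).
rewrite iterS; rewrite iterS in HSk; rewrite E in Hk HSk R *.
exists (n + (size (codes (s :: u)) + 1)).
  by rewrite mulSn addnC addn1 leq_add.
by apply: reach_trans R _; apply: pass_step; rewrite ?leq_add.
Qed.

Theorem rewriting_poly_computable (f : seq bool -> seq bool) (k B : nat -> nat) :
  polynomial k -> polynomial B ->
  (forall w, let w0 := map inp w ++ tail in
     exists p s u, [/\ p <= k (size w), iter p (rw_step h) w0 = s :: u,
       stop s, flatten (map raw u) = f w &
       (forall i, i < p -> exists s u, iter i (rw_step h) w0 = s :: u /\ ~~ stop s)
       /\ (forall i, i <= p -> size (iter i (rw_step h) w0) <= B (size w))]) ->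
  poly_computable f.
Proof.
move=> Hk HB H.
pose R := \max_a size (raw a).
have HR u : size (flatten (map raw u)) <= R * size u.
  elim: u => //= a u IH; rewrite size_cat mulnS leq_add //.
  exact: (leq_bigmax a).
pose C n := #|L| * B n.
pose D n := n + (C n + C n + R * B n).
(* Steps of the input pass, of the rewriting passes and of the output pass, each costing at most a
   round trip over [D n] squares. *)
pose T n := ((n + 1) + (k n * (C n).+1 + C n)) * (2 * (D n + max_out rw_rd rw_en) + 6) + 1.
have pC : polynomial C by apply: polynomial_mul (polynomial_const _) HB.
have pD : polynomial D.
  apply: polynomial_add polynomial_id _; apply: polynomial_add.
    exact: polynomial_add.
  by apply: polynomial_mul HB; apply: polynomial_const.
have pT : polynomial T.
  have pc K : polynomial (fun=> K) := polynomial_const K.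
  apply: polynomial_add (pc 1); apply: polynomial_mul.
    apply: polynomial_add.
      exact: polynomial_add polynomial_id (pc 1).
    apply: polynomial_add (pC); apply: polynomial_mul Hk _.
    apply: (@polynomial_le _ (fun n => 1 + C n)) => //.
    exact: polynomial_add (pc 1) pC.
  apply: polynomial_add (pc 6); apply: polynomial_mul (pc 2) _.
  exact: polynomial_add pD (pc _).
have [c Hc] := polynomial_bound pT.
exists (pm_tm (None, ord0) rw_rd rw_en), c => w.
have [p [s [u [Hp Ep Es Ew [Hi Hsz]]]]] := H w.
set n := size w in Hp Hsz; set w0 := _ ++ _ in Ep Hi Hsz.
have HC i : i <= p -> size (codes (iter i (rw_step h) w0)) <= C n.
  by move=> Hip; apply: leq_trans (size_codes _) _; rewrite leq_mul2l Hsz ?orbT.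
have [m Hm Rm] := iter_passes Hi HC.
have R0 : reach (D n) (n + 1) ((None, ord0), w, [::])
    ((Some None, ord0), codes w0, [::]).
  apply: input_pass; rewrite leq_add2l -addnA.
  by apply: leq_trans (HC 0 _) (leq_addr _ _).
have mono x y B1 B2 n1 : B1 <= B2 -> reach B1 n1 x y -> reach B2 n1 x y.
  move=> HB12 [E1 H1]; split=> // i /H1; case: (iter _ _ _) => [[a b] d] /=.
  by case/andP=> -> /leq_trans; apply.
have R1 := reach_trans R0 (mono _ _ _ (D n) _ _ Rm).
have Hu : size u < B n.
  by have := Hsz p (leqnn _); rewrite Ep.
have R2 : reach (D n) (size (codes (s :: u))) ((Some None, ord0), codes (s :: u), [::])
    ((Some (Some s), ord0), [::], f w).
  have <- : outs s u = f w by rewrite -Ew /outs /= Es.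
  apply: pass_first; rewrite /outs /= Es.
  rewrite /D addnA; apply: leq_add.
    apply: leq_trans (leq_addl _ _); rewrite -Ep.
    by apply: leq_trans (HC p _) (leq_addl _ _).
  by apply: leq_trans (HR _) _; rewrite leq_mul2l ltnW ?orbT.
rewrite Ep in R1.
have [|E3 H3] := reach_trans (R1 _) R2.
  by rewrite /D addnCA leq_addr.
have [|t [Ht Hh Ho]] := pm_computes E3 _ H3; first by rewrite /rw_en /= Es.
exists t; split=> //; apply: leq_trans Ht (leq_trans _ (Hc n)).
rewrite leq_add2r leq_mul2r; apply/orP; right.
rewrite -addnA leq_add2l leq_add //; last by rewrite -Ep HC.
by rewrite (leq_trans Hm) // leq_mul2r Hp orbT.
Qed.
End Rewriting.

(** * Gadgets over the bowtie *)

(** Parity is the level in the bowtie: 0 and 2 are minimal, 1 and 3 are maximal. *)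
Lemma bowtie_leE (a b : 'I_4) :
  bowtie_le a b = (a == b) || (~~ odd a && odd b).
Proof. by case: a b => [[|[|[|[|a]]]] Ha] [[|[|[|[|b]]]] Hb]. Qed.

Lemma bowtie_le_min (a b : 'I_4) : bowtie_le a b -> ~~ odd b -> a = b.
Proof. by rewrite bowtie_leE => /orP [/eqP //|/andP [_ ->]]. Qed.

Lemma bowtie_le_max (a b : 'I_4) : bowtie_le a b -> odd a -> a = b.
Proof. by rewrite bowtie_leE => /orP [/eqP //|/andP [/negPf ->]]. Qed.

(** This drives the gadget: when the upper bounds differ, the middle element is minimal, so whatever
    lies below it equals it. *)
Lemma below_two_maximal (z b b' : 'I_4) :
  bowtie_le z b -> bowtie_le z b' -> b != b' -> ~~ odd z.
Proof.
move=> H H' Hb; apply/negP => Hz.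
by move: Hb; rewrite -(bowtie_le_max H Hz) -(bowtie_le_max H' Hz) eqxx.
Qed.

Notation bsat := (sat bowtie_le).

Lemma sat_ext (e e' : nat -> 'I_4) phi : e =1 e' -> bsat e phi -> bsat e' phi.
Proof.
elim: phi e e' => [i j|i j|p IHp q IHq|i p IHp|i p IHp] e e' E /=; rewrite ?E //.
- by move=> [Hp Hq]; split; [apply: IHp Hp|apply: IHq Hq].
- by move=> H a; apply: IHp (H a) => v; rewrite /upd E.
- by move=> [a H]; exists a; apply: IHp H => v; rewrite /upd E.
Qed.

(* Variables 4, 5 hold the two truth values (minimal elements) and 6, 7 the
   two maximal elements; 8 to 11 are scratch. *)
Definition gadget (a a' b b' : nat) : cpformula :=
  FEx 11 (FAnd (FLe a 11) (FAnd (FLe a' 11) (FAnd (FLe 11 b) (FLe 11 b')))).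

(** Variable 10 is a selector: the literal is enforced as soon as it differs from variable 7. *)
Definition lit_formula (l : nat * bool) : cpformula :=
  gadget l.1 (if l.2 then 5 else 4) 10 7.

(** Suppose the constants are distinct. Lying above both truth values makes the selector maximal,
    and if [u] and [u'] differ, the gadget makes it equal to variable 6, hence different from
    variable 7, which switches the literals on. *)
Definition row_formula (row : seq (nat * bool)) (u u' : nat) : cpformula :=
  FEx 10 (FAnd (FLe 4 10) (FAnd (FLe 5 10) (FAnd (gadget u u' 10 6)
    (foldr (fun l => FAnd (lit_formula l)) (FEq 4 4) row)))).

(** Only neighbours on the chain are compared, so two alternating names serve chains of any
    length. *)
Definition flip_var (u : nat) : nat := if u == 8 then 9 else 8.

(* A chain of elements leads from variable 4 to variable 5; a step of the
   chain between distinct elements forces all literals of its row. *)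
Fixpoint chain_formula (rows : seq (seq (nat * bool))) (u : nat) : cpformula :=
  match rows with
  | [::] => FEq u 5
  | row :: rows' => FEx (flip_var u)
      (FAnd (row_formula row u (flip_var u)) (chain_formula rows' (flip_var u)))
  end.

Definition table_formula rows := chain_formula rows 4.

Definition lit_holds (e : nat -> 'I_4) (l : nat * bool) : bool :=
  e l.1 == e (if l.2 then 5 else 4).

Definition first_var : nat := 12.

Definition proper_rows (rows : seq (seq (nat * bool))) : bool :=
  all (all (fun l => first_var <= l.1)) rows.

Definition same_env (e e' : nat -> 'I_4) :=
  forall v, (3 < v < 8) || (11 < v) -> e v = e' v.

Lemma kept_var v i : (3 < v < 8) || (11 < v) -> 7 < i < 12 -> (v == i) = false.
Proof. by move=> H Hi; apply/eqP => E; move: H; rewrite E; lia. Qed.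

Lemma chain_var u : u < 10 -> (u == 10) = false /\ (u == 11) = false.
Proof. by move=> Hu; rewrite !ltn_eqF // (ltn_trans Hu). Qed.

Lemma flip_varP u : [/\ flip_var u < 10, (u == flip_var u) = false &
  7 < flip_var u < 12].
Proof. by rewrite /flip_var; case: (u =P 8) => [->|/eqP/negbTE ->]. Qed.

Lemma lits_sound e row :
  bsat e (foldr (fun l => FAnd (lit_formula l)) (FEq 4 4) row) ->
  all (fun l => first_var <= l.1) row ->
  e 10 != e 7 -> all (lit_holds e) row.
Proof.
move=> H Hrow H10; elim: row H Hrow => //= -[v b] row IH.
move=> [[z Hz] H] /= /andP [Hv Hrow]; rewrite IH // andbT /lit_holds /=.
move: Hz; rewrite /upd /=.
have -> : (v == 11) = false by rewrite /first_var in Hv; lia.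
have -> : ((if b then 5 else 4) == 11) = false by case: b.
move=> [H1 [H2 [H3 H4]]]; have Hz := below_two_maximal H3 H4 H10.
by rewrite (bowtie_le_min H1 Hz) (bowtie_le_min H2 Hz).
Qed.

Lemma chain_sound e e0 rows u : same_env e e0 -> proper_rows rows ->
  odd (e0 6) -> odd (e0 7) -> e0 6 != e0 7 -> ~~ odd (e0 4) -> ~~ odd (e0 5) ->
  e0 4 != e0 5 -> (u < 10) -> e u != e 5 ->
  bsat e (chain_formula rows u) -> has (all (lit_holds e0)) rows.
Proof.
move=> He Hrows H6 H7 H67 H4 H5 H45; elim: rows e u He Hrows => [|row rows IH] e u He /=.
  by move=> _ _ /negP Hu E; case: Hu; apply/eqP.
move=> /andP [Hrow Hrows] Hu Hne [u' [[s] H] Hc].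
set w := flip_var u in H Hc.
have [Hw10 Hwu Hw] : [/\ w < 10, (u == w) = false & 7 < w < 12].
  exact: flip_varP.
have [Hws Hwz] := chain_var Hw10; have [Hus Huz] := chain_var Hu.
have [Eu|Eu] := eqVneq (e u) u'; last first.
  apply/orP; left.
  set e1 := upd _ 10 s in H; case: H => Hs4 [Hs5 [[z Hz] Hl]].
  have E1 : same_env e1 e0.
    by move=> v Hv; rewrite -He // /e1 /upd !kept_var.
  have Es : e1 10 = s by [].
  (* A minimal element cannot lie above both truth values. *)
  have Hs : odd s.
    apply/negP => /negP Hs.
    have := H45; rewrite -!E1 // (bowtie_le_min Hs4) ?(bowtie_le_min Hs5) ?eqxx //.
  (* Otherwise the gadget on [u] and the next chain variable would give [e u = u']. *)
  have Es6 : s = e0 6.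
    apply/eqP/negPn/negP => Hs6.
    move: Hz; rewrite /upd /= -!/(upd _ _ _).
    rewrite Huz Hwz [e1 6]E1 // [e1 10]Es.
    move=> [Z1 [Z2 [Z3 Z4]]]; have Hz := below_two_maximal Z3 Z4 Hs6.
    have := etrans (bowtie_le_min Z1 Hz) (esym (bowtie_le_min Z2 Hz)).
    rewrite /e1 /upd Hwu eqxx Hws Hus.
    by move/eqP; rewrite (negPf Eu).
  rewrite (eq_in_all (a2 := lit_holds e1)) ?(lits_sound Hl) //.
    by rewrite Es Es6 E1.
  move=> l /(allP Hrow) Hl1; rewrite /lit_holds !E1 //.
    by case: l.2.
  by rewrite Hl1 orbT.
apply/orP; right; apply: (IH (upd e w u') w) => //.
- by move=> v Hv; rewrite -He // /upd kept_var.
by rewrite {1}/upd eqxx -Eu /upd kept_var.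
Qed.

Lemma table_sound (e : nat -> 'I_4) rows : proper_rows rows ->
  odd (e 6) -> odd (e 7) -> e 6 != e 7 -> ~~ odd (e 4) -> ~~ odd (e 5) ->
  e 4 != e 5 -> bsat e (table_formula rows) -> has (all (lit_holds e)) rows.
Proof. by move=> *; apply: (@chain_sound e e rows 4). Qed.

(** Distinctness is left out: for unfavourable values of the universal variables the constants may
    coincide, and completeness has to cover that case. *)
Definition truth_env (e : nat -> 'I_4) : bool :=
  [&& ~~ odd (e 4), ~~ odd (e 5), odd (e 6) & odd (e 7)].

Lemma bowtie_le_min_max (a b : 'I_4) : ~~ odd a -> odd b -> bowtie_le a b.
Proof. by rewrite bowtie_leE => -> ->; rewrite orbT. Qed.

Lemma bowtie_lexx (a : 'I_4) : bowtie_le a a.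
Proof. by rewrite bowtie_leE eqxx. Qed.

Lemma truth_env_same e e' : same_env e e' -> truth_env e -> truth_env e'.
Proof. by move=> E; rewrite /truth_env !E. Qed.

Lemma lits_complete e row : truth_env e ->
  all (fun l => (first_var <= l.1) && ((e l.1 == e 4) || (e l.1 == e 5))) row ->
  odd (e 10) -> (e 10 = e 7) \/ all (lit_holds e) row ->
  bsat e (foldr (fun l => FAnd (lit_formula l)) (FEq 4 4) row).
Proof.
move=> /and4P [H4 H5 H6 H7] + H10; elim: row => [|[v b] row IH] //=.
move=> /andP [/andP [Hv Hv'] Hrow] Hr; split; last first.
  by apply: IH => //; case: Hr => [|/andP [_]]; [left|right].
(* With the selector off, the common upper bound itself lies in the middle; otherwise the literal
   holds and its value does. *)
exists (if e 10 == e 7 then e 7 else e v); rewrite /upd /=.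
have -> : (v == 11) = false by rewrite /first_var in Hv; lia.
have -> : ((if b then 5 else 4) == 11) = false by case: ifP.
have Hb : ~~ odd (e (if b then 5 else 4)) by case: ifP.
have Hev : ~~ odd (e v) by case/orP: Hv' => /eqP ->.
case: eqP Hr => [E _|Hne [//|/andP [/eqP /= E _]]].
  by rewrite E bowtie_lexx !bowtie_le_min_max.
by rewrite -E bowtie_lexx !bowtie_le_min_max.
Qed.

(** [done] tells whether the chain has already jumped from false to true. It jumps at the first row
    that holds, so before the jump such a row must still lie ahead. *)
Lemma chain_complete e e0 rows u done : same_env e e0 -> truth_env e0 ->
  all (all (fun l => (first_var <= l.1) &&
                     ((e0 l.1 == e0 4) || (e0 l.1 == e0 5)))) rows ->
  (u < 10) -> e u = (if done then e0 5 else e0 4) ->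
  done || has (all (lit_holds e0)) rows ->
  bsat e (chain_formula rows u).
Proof.
move=> He Ht; elim: rows e u done He => [|row rows IH] e u dn He /=.
  by move=> _ _ ->; rewrite orbF => ->; rewrite He.
move=> /andP [Hrow Hrows] Hu Eu Hd.
have [now Enow] : {b | b = ~~ dn && all (lit_holds e0) row} by eexists.
set w := flip_var u.
have [Hw10 Hwu Hw] : [/\ w < 10, (u == w) = false & 7 < w < 12].
  exact: flip_varP.
have [Hws Hwz] := chain_var Hw10; have [Hus Huz] := chain_var Hu.
pose u' := if dn || now then e0 5 else e0 4.
exists u'; split; last first.
  apply: (IH _ _ (dn || now)) => //.
  - by move=> v Hv; rewrite -He // /upd kept_var.
  - by rewrite /upd eqxx.
  by move: Hd; rewrite Enow; case: (dn) => //=; case: (all _ row).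
have /and4P [H4 H5 H6 H7] := Ht.
(* At the jump the selector must agree with variable 6, and the literals hold; elsewhere variable 7
   switches them off. *)
exists (if now then e0 6 else e0 7).
set e1 := upd _ 10 _.
have E1 : same_env e1 e0.
  by move=> v Hv; rewrite -He // /e1 /upd !kept_var.
have Es : e1 10 = if now then e0 6 else e0 7 by [].
have Hs : odd (e1 10) by rewrite Es; case: ifP.
have Eu1 : e1 u = if dn then e0 5 else e0 4.
  by rewrite /e1 /upd Hwu Hus.
have Ew1 : e1 w = u' by rewrite /e1 /upd Hws eqxx.
split; first by apply: bowtie_le_min_max => //; rewrite -/e1 E1.
split; first by apply: bowtie_le_min_max => //; rewrite -/e1 E1.
split.
  exists (if now then e0 6 else u'); rewrite /= /upd /= -!/(upd _ _ _).
  rewrite Huz Hwz Eu1 Ew1 [e1 6]E1 // [e1 10]Es /u'.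
  have [En|En] := boolP now; rewrite /= ?orbT ?orbF.
    move: En; rewrite Enow => /andP [/negbTE -> _].
    by rewrite bowtie_lexx !bowtie_le_min_max.
  by case: (dn); rewrite bowtie_lexx !bowtie_le_min_max.
apply: lits_complete => //.
- by apply: truth_env_same Ht => v Hv; rewrite E1.
- apply: sub_all Hrow => l /andP [Hl]; rewrite !E1 ?Hl //.
  by apply/orP; right.
rewrite Es [e1 7]E1 //; have [En|En] := boolP now; [right|by left].
move: En; rewrite Enow => /andP [_ H]; apply/allP => l Hl.
move: (allP H l Hl) (allP Hrow l Hl); rewrite /lit_holds => El /andP [Hl1 _].
have Eb : e1 (if l.2 then 5 else 4) = e0 (if l.2 then 5 else 4).
  by rewrite E1 //; case: (l.2).
by rewrite (E1 l.1) ?Eb //; apply/orP; right.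
Qed.

Lemma table_complete e rows : truth_env e ->
  all (all (fun l => (first_var <= l.1) &&
                     ((e l.1 == e 4) || (e l.1 == e 5)))) rows ->
  has (all (lit_holds e)) rows -> bsat e (table_formula rows).
Proof. by move=> *; apply: (@chain_complete e e rows 4 false). Qed.

Lemma gadget_free v a a' b b' : free_in v (gadget a a' b b') ->
  v \in [:: a; a'; b; b'].
Proof. by rewrite /= !inE; case: (v == 11); rewrite //= !orbF; do !case: eqP. Qed.

Lemma table_free v rows : free_in v (table_formula rows) ->
  (3 < v < 8) || has (has (fun l => v == l.1)) rows.
Proof.
rewrite /table_formula => H.
suff : forall u, free_in v (chain_formula rows u) ->
  [|| v == u, 3 < v < 8 | has (has (fun l => v == l.1)) rows].
  by move=> /(_ 4 H); case: eqP => [->|].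
move=> u {H}; elim: rows u => [|row rows IH] u /=.
  by case/orP=> /eqP ->; rewrite ?eqxx ?orbT.
case/andP=> Hw /orP [|/IH]; last first.
  by rewrite (negPf Hw) /= => /orP [->|->]; rewrite !orbT.
case/andP=> H10 H.
have Hl : free_in v (foldr (fun l => FAnd (lit_formula l)) (FEq 4 4) row) ->
    (3 < v < 8) || has (fun l => v == l.1) row.
  elim: row {H} => [/orP[]/eqP -> //|[l b] row IHr].
  case/orP=> [/gadget_free|/IHr /orP [->|/= ->]]; rewrite ?orbT //.
  rewrite !inE (negPf H10) /=.
  by case/or3P=> [->|/eqP ->|/eqP ->]; rewrite ?orbT //; case: b.
case/orP: H => [/orP [/eqP ->|E]|]; rewrite ?orbT //; first by rewrite E in H10.
case/orP=> [/orP [/eqP ->|E]|]; rewrite ?orbT //; first by rewrite E in H10.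
case/orP=> [/gadget_free|/Hl /orP [->|->]]; rewrite ?orbT //.
rewrite !inE (negPf H10) (negPf Hw) /=.
by case/orP=> [->//|/eqP ->]; rewrite orbT.
Qed.

(** * Constraint satisfaction as truth in the bowtie *)

Section ConstraintFormula.
Variables (S : finType) (s0 : S).

(* Record [j] stores an element of [S] in unary, one variable for each
   possible value. *)
Definition rvar (j : nat) (a : S) : nat := first_var + #|S| * j + enum_rank a.

Lemma rvar_inj j a j' a' : rvar j a = rvar j' a' -> j = j' /\ a = a'.
Proof.
rewrite /rvar -!addnA => /addnI; rewrite !(mulnC #|S|) => E.
have Hj : j = j'.
  move: (congr1 (divn^~ #|S|) E).
  by rewrite !divnMDl ?divn_small ?addn0 // (leq_ltn_trans _ (ltn_ord (enum_rank a))).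
split=> //; apply: enum_rank_inj; apply: val_inj.
by move: E; rewrite Hj => /addnI.
Qed.

Lemma rvar_first j a : first_var <= rvar j a.
Proof. by rewrite /rvar -addnA leq_addr. Qed.

Definition rec_vars j := [seq rvar j a | a <- enum S].

Lemma rec_varsP v j : reflect (exists a, v = rvar j a) (v \in rec_vars j).
Proof.
apply: (iffP mapP) => [[a _ ->]|[a ->]]; exists a => //.
by rewrite mem_enum.
Qed.

(* A block declares record [b_own] and constrains the records [b_recs] to
   form one of the rows [b_rows]. *)
Definition block := (nat * seq nat * seq (seq S))%type.
Definition b_own (b : block) := b.1.1.
Definition b_recs (b : block) := b.1.2.
Definition b_rows (b : block) := b.2.

(** Negative literals are included, so a row that holds fixes the complete one-hot code of each
    record. *)
Definition row_lits (rs : seq nat) (row : seq S) : seq (nat * bool) :=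
  flatten [seq [seq (rvar p.1 a, a == p.2) | a <- enum S] | p <- zip rs row].

Definition block_table (b : block) : cpformula :=
  table_formula [seq row_lits (b_recs b) row | row <- b_rows b].

Definition block_formula (b : block) (rest : cpformula) : cpformula :=
  foldr FEx (FAnd (block_table b) rest) (rec_vars (b_own b)).

Definition csp_body (bs : seq block) : cpformula :=
  foldr block_formula (FEq 4 4) bs.

(** If variables 0 to 3 take the values 0, 2, 1, 3, the inequalities force variables 4 to 7 to equal
    them; for all other values there is still a minimal element below or a maximal one above. *)
Definition csp_prefix (phi : cpformula) : cpformula :=
  FAll 0 (FAll 1 (FAll 2 (FAll 3 (FEx 4 (FEx 5 (FEx 6 (FEx 7
    (FAnd (FLe 4 0) (FAnd (FLe 5 1) (FAnd (FLe 2 6) (FAnd (FLe 3 7) phi))))))))))).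

Definition csp_formula bs := csp_prefix (csp_body bs).

Definition satisfies (x : nat -> S) (b : block) : bool :=
  map x (b_recs b) \in b_rows b.

(** No record is declared twice, so the quantifiers of a later block cannot change what an earlier
    block has constrained. *)
Fixpoint scoped (D : seq nat) (bs : seq block) : bool :=
  if bs is b :: bs' then
    [&& b_own b \notin D, all (mem (b_own b :: D)) (b_recs b),
        all (fun row => size row == size (b_recs b)) (b_rows b) &
        scoped (b_own b :: D) bs']
  else true.

Lemma row_litsP rs row l : l \in row_lits rs row ->
  exists j s a, [/\ (j, s) \in zip rs row & l = (rvar j a, a == s)].
Proof.
case/flattenP => _ /mapP [[j s] Hjs ->] /mapP [a _ ->].
by exists j, s, a.
Qed.

Lemma row_lits_mem rs row j s a : (j, s) \in zip rs row ->
  (rvar j a, a == s) \in row_lits rs row.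
Proof.
move=> H; apply/flattenP; exists [seq (rvar j a, a == s) | a <- enum S].
  by apply/mapP; exists (j, s).
by apply/mapP; exists a; rewrite ?mem_enum.
Qed.

Lemma mem_zip1 (T1 T2 : eqType) (s : seq T1) (t : seq T2) x y :
  (x, y) \in zip s t -> x \in s.
Proof.
elim: s t => [|a s IH] [|b t] //=; rewrite !inE.
by case/orP=> [/eqP [-> _]|/IH ->]; rewrite ?eqxx ?orbT.
Qed.

Definition upds (e : nat -> 'I_4) (vs : seq nat) (g : nat -> 'I_4) v :=
  if v \in vs then g v else e v.

Lemma sat_exists_sound vs e phi : bsat e (foldr FEx phi vs) ->
  exists e', (forall v, v \notin vs -> e' v = e v) /\ bsat e' phi.
Proof.
elim: vs e => [|w vs IH] e /=; first by exists e.
move=> [a /IH [e' [E H]]]; exists e'; split=> // v.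
by rewrite inE negb_or => /andP [/negPf Hv /E ->]; rewrite /upd Hv.
Qed.

Lemma sat_exists_complete vs e g phi :
  bsat (upds e vs g) phi -> bsat e (foldr FEx phi vs).
Proof.
elim: vs e => [|w vs IH] e /=; first by apply: sat_ext.
move=> H; exists (g w); apply: IH; apply: sat_ext H => v.
by rewrite /upds /upd inE; case: (v =P w) => [->|//] /=; case: ifP.
Qed.

Definition block_matches (e : nat -> 'I_4) (b : block) : bool :=
  has (fun row => all (lit_holds e) (row_lits (b_recs b) row)) (b_rows b).

Lemma block_proper b : proper_rows [seq row_lits (b_recs b) row | row <- b_rows b].
Proof.
rewrite /proper_rows all_map; apply/allP => row _; apply/allP => l.
by case/row_litsP => j [s [a [_ ->]]]; apply: rvar_first.
Qed.

Lemma block_matches_ext e e' b :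
  (forall v, 3 < v < 8 -> e v = e' v) ->
  (forall j a, j \in b_recs b -> e (rvar j a) = e' (rvar j a)) ->
  block_matches e b -> block_matches e' b.
Proof.
move=> Ec Er /hasP [row Hrow /allP H]; apply/hasP; exists row => //.
apply/allP => l Hl; move: (H l Hl); rewrite /lit_holds.
have [j [s [a [Hj ->]]]] := row_litsP Hl.
rewrite /= Er ?(mem_zip1 Hj) //.
have -> // : e (if a == s then 5 else 4) = e' (if a == s then 5 else 4).
by case: ifP => _; rewrite Ec.
Qed.

Definition distinct_env (e : nat -> 'I_4) : bool :=
  [&& truth_env e, e 4 != e 5 & e 6 != e 7].

Lemma distinct_env_ext e e' : (forall v, 3 < v < 8 -> e v = e' v) ->
  distinct_env e -> distinct_env e'.
Proof. by move=> E; rewrite /distinct_env /truth_env !E. Qed.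

Lemma const_rec_vars v j : 3 < v < 8 -> v \notin rec_vars j.
Proof.
move=> Hv; apply/negP => /rec_varsP [a E]; have := rvar_first j a.
by rewrite -E /first_var; lia.
Qed.

Lemma body_sound bs D e : scoped D bs -> distinct_env e ->
  bsat e (csp_body bs) ->
  exists e', [/\ forall v, 3 < v < 8 -> e v = e' v,
    forall j a, j \in D -> e (rvar j a) = e' (rvar j a) &
    all (block_matches e') bs].
Proof.
elim: bs D e => [|b bs IH] D e; first by exists e.
move=> /= /and4P [HD Hrs Hsz Hsc] He /sat_exists_sound [e1 [E1 [Ht Hb]]].
have Ec v : 3 < v < 8 -> e v = e1 v.
  by move=> Hv; rewrite E1 // const_rec_vars.
have He1 := distinct_env_ext Ec He.
have [e2 [Ec2 Er2 Hall]] := IH _ _ Hsc He1 Hb.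
exists e2; split.
- by move=> v Hv; rewrite Ec // Ec2.
- move=> j a Hj; rewrite -Er2 ?inE ?Hj ?orbT // E1 //.
  apply/negP => /rec_varsP [a' /rvar_inj [E _]].
  by rewrite -E Hj in HD.
rewrite /= Hall andbT; apply: (block_matches_ext Ec2).
  by move=> j a Hj; rewrite Er2 //; apply: (allP Hrs).
case/and3P: He1 => /and4P [H4 H5 H6 H7] H45 H67.
have := table_sound (block_proper b) H6 H7 H67 H4 H5 H45 Ht.
by rewrite has_map.
Qed.

Lemma zip_map_mem (x : nat -> S) rs (row : seq S) : size row = size rs ->
  (forall j s, (j, s) \in zip rs row -> x j = s) -> map x rs = row.
Proof.
elim: rs row => [|j rs IH] [|s row] //= [Hsz] H.
rewrite (H j s) ?mem_head // (IH row) // => j' s' H'.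
by apply: H; rewrite inE H' orbT.
Qed.

Lemma scoped_size D bs b row : scoped D bs -> b \in bs -> row \in b_rows b ->
  size row = size (b_recs b).
Proof.
elim: bs D => // b' bs IH D /= /and4P [_ _ Hsz Hsc]; rewrite inE.
case/orP=> [/eqP -> /(allP Hsz) /eqP //|]; exact: IH Hsc.
Qed.

Lemma csp_sound bs : scoped [::] bs -> bowtie_models (csp_formula bs) ->
  exists x, all (satisfies x) bs.
Proof.
move=> Hsc H.
pose o k : 'I_4 := inord k.
have ok k : k < 4 -> o k = k :> nat by move=> Hk; rewrite inordK.
have [X [Y [P [Q [HX [HY [HP [HQ Hb]]]]]]]] := H (fun=> o 0) (o 0) (o 2) (o 1) (o 3).
rewrite /upd /= in HX HY HP HQ.
have EX := bowtie_le_min HX; have EY := bowtie_le_min HY.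
have EP := bowtie_le_max HP; have EQ := bowtie_le_max HQ.
set e := upd _ 7 Q in Hb.
have He : distinct_env e.
  rewrite /distinct_env /truth_env /e /upd /= EX ?ok // EY ?ok // -EP ?ok // -EQ ?ok //.
  by rewrite -!val_eqE /= !ok.
have [e' [Ec _ /allP Hall]] := body_sound Hsc He Hb.
case/and3P: (distinct_env_ext Ec He) => _ H45 _.
(* A record takes a value whose variable is true; [s0] stands in for records without one. *)
exists (fun j => odflt s0 [pick a | e' (rvar j a) == e' 5]).
apply/allP => b Hbs; have /hasP [row Hrow /allP Hl] := Hall b Hbs.
have Hsize := scoped_size Hsc Hbs Hrow.
rewrite /satisfies; erewrite zip_map_mem; [exact: Hrow|exact: Hsize|].
move=> j s Hjs; case: pickP => [a /eqP Ha|/(_ s)] /=.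
  have := Hl _ (row_lits_mem a Hjs); rewrite /lit_holds /= Ha.
  by case: (a =P s) => // _; rewrite eq_sym (negPf H45).
have := Hl _ (row_lits_mem s Hjs); rewrite /lit_holds /= eqxx.
by move=> ->.
Qed.

Lemma body_complete bs D e x : scoped D bs -> truth_env e ->
  (forall j a, j \in D -> e (rvar j a) = e (if a == x j then 5 else 4)) ->
  all (satisfies x) bs -> bsat e (csp_body bs).
Proof.
elim: bs D e => [|b bs IH] D e //= /and4P [HD Hrs Hsz Hsc] He Hx /andP [Hb Hall].
pose j0 := b_own b.
pose g v := if [pick a | v == rvar j0 a] is Some a
            then e (if a == x j0 then 5 else 4) else e v.
apply: (@sat_exists_complete _ _ g).
set e1 := upds _ _ _.
have Ec v : 3 < v < 8 -> e v = e1 v.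
  by move=> Hv; rewrite /e1 /upds (negPf (const_rec_vars _ Hv)).
have Ec' (t : bool) : e1 (if t then 5 else 4) = e (if t then 5 else 4).
  by case: t; rewrite Ec.
have He1 : truth_env e1 by move: He; rewrite /truth_env !Ec.
have Hx1 j a : j \in j0 :: D -> e1 (rvar j a) = e1 (if a == x j then 5 else 4).
  rewrite Ec' inE => Hj; rewrite /e1 /upds; case: rec_varsP => [[a' E]|Hn].
    have [-> ->] := rvar_inj E; rewrite /g; case: pickP => [a2 /eqP E2|/(_ a')].
      by have [_ ->] := rvar_inj E2.
    by rewrite eqxx.
  case/orP: Hj => [/eqP Ej|]; last exact: Hx.
  by case: Hn; exists a; rewrite Ej.
split; last exact: IH Hsc He1 Hx1 Hall.
have Hin j : j \in b_recs b -> j \in j0 :: D by move=> Hj; apply: (allP Hrs).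
have Hl row l : l \in row_lits (b_recs b) row ->
    exists j s a, [/\ (j, s) \in zip (b_recs b) row, l = (rvar j a, a == s) &
      e1 l.1 = e1 (if a == x j then 5 else 4)].
  case/row_litsP => j [s [a [Hj ->]]]; exists j, s, a; split=> //=.
  by rewrite Hx1 // Hin // (mem_zip1 Hj).
apply: table_complete => //.
  rewrite all_map; apply/allP => row _; apply/allP => l Hl1.
  have [j [s [a [_ El ->]]]] := Hl _ _ Hl1; rewrite {1}El rvar_first /=.
  by case: ifP; rewrite eqxx ?orbT.
rewrite has_map; apply/hasP; exists (map x (b_recs b)) => //.
apply/allP => l Hl1; have [j [s [a [Hj El E1]]]] := Hl _ _ Hl1.
rewrite /lit_holds E1 El /=.
suff -> : s = x j by [].
elim: (b_recs b) Hj => //= j' rs IHrs; rewrite inE.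
by case/orP=> [/eqP [-> ->]|].
Qed.

Lemma csp_complete bs x : scoped [::] bs -> all (satisfies x) bs ->
  bowtie_models (csp_formula bs).
Proof.
move=> Hsc Hx e a b c d.
pose o k : 'I_4 := inord k.
have ok k : k < 4 -> o k = k :> nat by move=> Hk; rewrite inordK.
(* A universal value of the right level is kept; otherwise any fixed element of that level is
   comparable to it. *)
pose lo (a : 'I_4) := if odd a then o 0 else a.
pose hi (a : 'I_4) := if odd a then a else o 1.
have Hlo a1 : ~~ odd (lo a1) /\ bowtie_le (lo a1) a1.
  by rewrite /lo bowtie_leE; case: (boolP (odd a1)) => H; rewrite ?ok //= ?eqxx ?orbT.
have Hhi a1 : odd (hi a1) /\ bowtie_le a1 (hi a1).
  by rewrite /hi bowtie_leE; case: (boolP (odd a1)) => H; rewrite ?ok //= ?eqxx ?orbT.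
exists (lo a), (lo b), (hi c), (hi d).
have [La La'] := Hlo a; have [Lb Lb'] := Hlo b.
have [Hc Hc'] := Hhi c; have [Hd Hd'] := Hhi d.
do 4!split => //.
by apply: body_complete Hsc _ _ Hx => //; apply/and4P.
Qed.

Lemma free_in_exists v vs phi :
  free_in v (foldr FEx phi vs) = (v \notin vs) && free_in v phi.
Proof. by elim: vs => //= w vs ->; rewrite inE negb_or andbA. Qed.

Lemma body_free bs D v : scoped D bs -> free_in v (csp_body bs) ->
  (3 < v < 8) \/ exists2 j, j \in D & v \in rec_vars j.
Proof.
elim: bs D => [|b bs IH] D /=.
  by move=> _ /orP[] /eqP ->; left.
move=> /and4P [HD Hrs Hsz Hsc]; rewrite /block_formula free_in_exists.
case/andP=> Hv Hf.
suff [|[j Hj Hj']] : (3 < v < 8) \/ exists2 j, j \in b_own b :: D & v \in rec_vars j.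
- by left.
- right; exists j => //; move: Hj; rewrite inE.
  by case/orP=> // /eqP E; rewrite -E Hj' in Hv.
case/orP: Hf => [/table_free /orP [|]|]; [by left| |exact: IH].
rewrite has_map => /hasP [row _ /hasP [l Hl /eqP E]]; right.
have [j [s [a [Hj El]]]] := row_litsP Hl; exists j.
  by apply: (allP Hrs); apply: mem_zip1 Hj.
by apply/rec_varsP; exists a; rewrite E El.
Qed.

Lemma csp_sentence bs : scoped [::] bs -> sentence (csp_formula bs).
Proof.
move=> Hsc v; apply/negP; rewrite /csp_formula.
have Hb : free_in v (csp_body bs) -> 3 < v < 8.
  by move/(body_free Hsc) => [//|[j]].
move: (csp_body bs) Hb => phi.
by case: v => [|[|[|[|[|[|[|[|v]]]]]]]] //= Hb /Hb; lia.
Qed.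
End ConstraintFormula.
Arguments b_own {S} b.
Arguments b_recs {S} b.
Arguments b_rows {S} b.

(** * Tableaux of Turing machine runs *)

Section Tableau.
Variable M : TM.
Notation Q := (tm_Q M).

(* Content of a tape square, with the state if the head is there. The extra
   state [None] sits one square before the input and moves onto it. *)
Definition cell : finType := (option bool * option (option Q))%type.
Definition blank : cell := (None, None).

Definition moves (q : option Q) (s : Sym) : option Q * Sym * Dir :=
  match q with
  | None => (Some (tm_start M), s, DR)
  | Some q => if tm_halt M q then (Some q, s, DS) else
              let: (q', a, d) := tm_delta M q s in (Some q', a, d)
  end.

Definition acfg := (option Q * nat * (nat -> Sym))%type.

Definition astep (c : acfg) : acfg :=
  let: (q, p, t) := c in
  let: (q', a, d) := moves q (t p) in
  (q', match d with DL => p.-1 | DR => p.+1 | DS => p end,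
   fun i => if i == p then a else t i).

Definition cell_at (c : acfg) (i : nat) : cell :=
  (c.2 i, if i == c.1.2 then Some c.1.1 else None).

Definition cell_moves (x : cell) : option (option Q * Sym * Dir) :=
  if x.2 is Some q then Some (moves q x.1) else None.

Definition next_cell (l c r : cell) : cell :=
  match cell_moves c with
  | Some (q, a, DS) => (a, Some q)
  | Some (q, a, _) => (a, None)
  | None => (c.1, match cell_moves l with
                  | Some (q, _, DR) => Some q
                  | _ => match cell_moves r with
                         | Some (q, _, DL) => Some q
                         | _ => None
                         end
                  end)
  end.

(** The head must not be on square 0, since there [p.-1] would turn a left move into a stay. *)
Lemma cell_at_step (c : acfg) i : 0 < c.1.2 ->
  cell_at (astep c) i.+1 =
  next_cell (cell_at c i) (cell_at c i.+1) (cell_at c i.+2).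
Proof.
case: c => [[q p] t] /= Hp; rewrite /cell_at /next_cell /cell_moves /=.
case E : (moves q (t p)) => [[q' a] d] /=.
have [->|H1] := eqVneq i.+1 p.
  rewrite E; case: d E => _; rewrite ?eqxx //; [rewrite gtn_eqF|rewrite ltn_eqF];
    by rewrite ?prednK.
have [E2|H2] := eqVneq i p.
  rewrite E2 E; have -> : (p.+2 == p) = false by lia.
  by case: d {E}; rewrite ?eqxx //; do ?case: eqP => //; lia.
have [E3|H3] := eqVneq i.+2 p.
  rewrite E3 E; case: d {E}; do ?case: eqP => //; lia.
by case: d {E}; do ?case: eqP => //; lia.
Qed.

Definition abs_view (c : config Q) (x : acfg) :=
  let: (q, p, t) := x in
  [/\ q = Some (c_st c),
      forall i, i < p -> nth None (c_left c) i = t (p.-1 - i) &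
      forall i, nth None (c_head c :: c_right c) i = t (p + i)].

Lemma abs_view_step c x : abs_view c x -> 0 < x.1.2 ->
  abs_view (tm_step c) (astep x).
Proof.
case: x c => [[q p] t] [st l h r] /= [-> El Er] Hp.
have Eh : h = t p by rewrite -[p]addn0 -(Er 0).
have Er' i : nth None r i = t (p + i.+1) by rewrite -(Er i.+1).
rewrite /tm_step /astep /= -Eh; case: (tm_halt M st).
  split=> //= i; [move=> /El ->|rewrite Er]; case: eqP => // E.
    by exfalso; lia.
  by rewrite E.
case: (tm_delta M st h) => [[q' a] []] /=.
- case: p Hp El Er Er' Eh => // p _ El Er Er' Eh.
  have El0 := El 0 isT.
  have El1 i : i < p -> nth None (behead l) i = t (p.-1 - i).
    by move=> Hi; rewrite nth_behead El //=; congr t; lia.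
  case: l El {El0 El1} (El0) (El1) => [|b l] El El0 El1; split=> //= i.
  + by move=> Hi; have := El1 i Hi; rewrite /= nth_nil => ->; case: eqP => //; lia.
  + case: i => [|[|i]] /=; rewrite ?addn0.
    * by rewrite ltn_eqF //; move: El0; rewrite /= subn0.
    * by rewrite addn1 eqxx.
    * by rewrite Er' addSnnS; case: eqP => //; lia.
  + by move=> Hi; rewrite [LHS](El1 i Hi); case: eqP => //; lia.
  + case: i => [|[|i]] /=; rewrite ?addn0.
    * by rewrite ltn_eqF //; move: El0; rewrite /= subn0.
    * by rewrite addn1 eqxx.
    * by rewrite Er' addSnnS; case: eqP => //; lia.
- have Hl i : i < p.+1 -> nth None (a :: l) i = if p - i == p then a else t (p - i).
    case: i => [|i] /= Hi; first by rewrite subn0 eqxx.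
    rewrite El //; have -> : (p - i.+1 == p) = false by lia.
    by congr t; lia.
  case: r Er Er' => [|b r] Er Er'; split=> //= i.
  + have := Er' i; rewrite nth_nil addSnnS => E0.
    by case: eqP => [|_]; [lia|rewrite -E0; case: (i) => [|[|k]]].
  + have := Er' i; rewrite addSnnS => <-.
    by case: eqP => [|_]; [lia|].
- split=> //= i.
    by move=> Hi; rewrite El //; case: eqP => //; lia.
  case: i => [|i] /=; first by rewrite addn0 eqxx.
  by rewrite Er'; case: eqP => //; lia.
Qed.

Variables (z : seq bool) (T B : nat).
Hypothesis HT : tm_halt M (c_st (tm_run M T z)).
Hypothesis HB : T.+1 < B.

(* The input starts on square [B + 1]. *)
Definition start_tape (i : nat) : Sym :=
  if B < i then nth None (map Some z) (i - B.+1) else None.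
Definition row (r : nat) : acfg := iter r astep (None, B, start_tape).

Lemma rowS r : row r.+1 = astep (row r).
Proof. by []. Qed.

(** Row 0 is spent on stepping from the extra state onto the input, so row [r.+1] is time [r]. The
    head moves at most one square per step, and [T.+1 < B] keeps it off square 0. *)
Lemma row_run r : r <= T -> abs_view (tm_run M r z) (row r.+1) /\
  B.+1 - r <= (row r.+1).1.2 <= B.+1 + r.
Proof.
elim: r => [|r IH] Hr.
  split; last by rewrite /= subn0 addn0 leqnn.
  rewrite /row /tm_run /= /astep /=; split=> //= i.
    move=> Hi; rewrite nth_nil /start_tape; case: eqP => _; rewrite ifN //; lia.
  case: eqP => [|_]; first by lia.
  have -> : start_tape (B.+1 + i) = nth None (map Some z) i.
    by rewrite /start_tape leq_addr addKn.
  by have [_ _ E] := tape_view_init M z; exact: E i.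
have [V Hp] := IH (ltnW Hr); split.
  by rewrite /tm_run iterS rowS; apply: abs_view_step V _; lia.
rewrite rowS; case: (row r.+1) Hp => [[q p] t] /=.
by case: (moves q (t p)) => [[q' a] []] /=; lia.
Qed.

Lemma row_halted r : T < r -> abs_view (tm_run M T z) (row r) /\
  B.+1 - T <= (row r).1.2 <= B.+1 + T.
Proof.
elim: r => // r IH; rewrite ltnS leq_eqVlt => /orP [/eqP <-|Hr].
  exact: row_run.
have [V Hp] := IH Hr; rewrite rowS.
split.
  rewrite (_ : tm_run M T z = tm_step (tm_run M T z)); last first.
    by case: (tm_run M T z) HT => /= ? ? ? ? ->.
  by apply: abs_view_step V _; lia.
case: (row r) V Hp => [[q p] t] [-> _ _] /=.
by rewrite HT.
Qed.

Lemma head_range r : B - T <= (row r).1.2 <= B.+1 + T.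
Proof.
have [/row_halted [_]|] := ltnP T r; first lia.
case: r => [_|r Hr]; first by rewrite /=; lia.
by have [_] := row_run (ltnW Hr); lia.
Qed.

Lemma row_sym r i : ~~ (B - T <= i <= B.+1 + T) -> (row r).2 i = start_tape i.
Proof.
move=> Hi; elim: r => // r IH; rewrite -IH rowS.
have := head_range r; case: (row r) => [[q p] t] /= Hp.
by case: (moves q (t p)) => [[q' a] d] /=; case: eqP => // E; move: Hi; rewrite E Hp.
Qed.

Lemma cell_blank r i : i < 2 \/ B.+1 + T + size z < i -> cell_at (row r) i = blank.
Proof.
move=> Hi; have Hr := head_range r; rewrite /cell_at row_sym; last by lia.
rewrite ifN; last by lia.
rewrite /start_tape; case: ifP => // Hb.
by rewrite nth_default // size_map; lia.
Qed.

(** A halted machine outputs [[:: true]] exactly when its head reads a one with a blank to the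
    right, so acceptance is a condition on two adjacent cells. *)
Definition accepts_ok (c r : cell) : bool :=
  if c.2 is Some (Some q) then
    tm_halt M q ==> (c.1 == Some true) && (r.1 == None)
  else true.

Lemma read_bits_true h (r : seq Sym) :
  (read_bits (h :: r) == [:: true]) = (h == Some true) && (nth None r 0 == None).
Proof. by case: h r => [[]|] [|[[]|] r]. Qed.

Lemma accepts_okP c x i : abs_view c x -> tm_halt M (c_st c) ->
  accepts_ok (cell_at x i) (cell_at x i.+1) = (i == x.1.2) ==> (tm_output c == [:: true]).
Proof.
case: x c => [[q p] t] [st l h r] /= [-> El Er] Hst.
rewrite /accepts_ok /cell_at /=; case: eqP => //= ->; rewrite Hst /= read_bits_true.
have /= -> := Er 0; have /= -> := Er 1.
by rewrite addn0 addn1.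
Qed.

Variables (W : nat).
Hypothesis HW : B.+1 + T + size z + 2 < W.

(* The rows are wound into one sequence, read from right to left: square [i]
   of row [r] is entry [r * W + (W - i)]. Squares 0 and [W] coincide, which is
   harmless since both stay blank. *)
Definition helix (n : nat) : cell := cell_at (row (n %/ W)) (W - n %% W).

Lemma helixE r i : i <= W -> helix (r * W + i) = cell_at (row r) (W - i).
Proof.
move=> Hi; rewrite /helix.
have [E|Hi'] := eqVneq i W; last first.
  by rewrite divnMDl ?modnMDl ?divn_small ?modn_small ?addn0 //; lia.
rewrite E -mulSnr mulnK ?modnMl; last lia.
by rewrite !cell_blank //; lia.
Qed.

Lemma helix_step n :
  helix (n + W.+1) = next_cell (helix n.+2) (helix n.+1) (helix n).
Proof.
have HW0 : 0 < W by lia.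
rewrite (divn_eq n W); set r := n %/ W; set i := n %% W.
have Hi : i < W by rewrite ltn_mod.
have -> : r * W + i + W.+1 = r.+1 * W + i.+1 by rewrite mulSn; lia.
rewrite -!addnS [helix (r.+1 * W + _)]helixE // [helix (r * W + i)]helixE 1?ltnW //.
rewrite [helix (r * W + i.+1)]helixE //.
have [E|Hi2] := eqVneq i.+1 W.
  (* At the seam the entry in the place of the left neighbour is square [W - 1] of the next row; all
     four cells involved are blank. *)
  have -> : r * W + i.+2 = r.+1 * W + 1 by rewrite mulSn; lia.
  rewrite helixE //.
  by rewrite !cell_blank //; lia.
rewrite helixE; last lia.
have -> : W - i.+1 = (W - i.+2).+1 by lia.
have -> : W - i = (W - i.+2).+2 by lia.
by rewrite -cell_at_step //; have := head_range r; lia.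
Qed.

Lemma helix_accepts : tm_output (tm_run M T z) == [:: true] ->
  forall n, accepts_ok (helix n.+1) (helix n).
Proof.
move=> Hacc n; have HW0 : 0 < W by lia.
rewrite (divn_eq n W); set r := n %/ W; set i := n %% W.
have Hi : i < W by rewrite ltn_mod.
rewrite -addnS !helixE //; last exact: ltnW.
have -> : W - i = (W - i.+1).+1 by lia.
have [Hr|Hr] := ltnP T r.
  have [V _] := row_halted Hr.
  by rewrite (accepts_okP _ V HT) Hacc implybT.
case: r Hr => [|r] Hr.
  by rewrite /accepts_ok /cell_at /=; case: eqP.
have [V _] := row_run (ltnW Hr).
have [Hh|Hh] := boolP (tm_halt M (c_st (tm_run M r z))).
  have E : tm_run M T z = tm_run M r z.
    rewrite -(subnKC (ltnW Hr)) tm_run_add; elim: (T - r) => //= k ->.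
    by case: (tm_run M r z) Hh => /= ? ? ? ? ->.
  by rewrite (accepts_okP _ V Hh) -E Hacc implybT.
rewrite /accepts_ok /cell_at; case: (row r.+1) V => [[q p] t] [-> _ _] /=.
by case: eqP => //= _; rewrite (negPf Hh).
Qed.

Lemma helix_rejects N : T.+2 * W <= N ->
  (forall n, n < N -> accepts_ok (helix n.+1) (helix n)) ->
  tm_output (tm_run M T z) == [:: true].
Proof.
move=> HN H; have [V Hp] := row_halted (leqnn T.+1).
set p := (row T.+1).1.2 in Hp.
(* The entry after this index is the head cell of row [T.+1], where the machine has halted. *)
have := H (T.+1 * W + (W - p.+1)).
rewrite -addnS !helixE; try lia.
have -> : W - (W - p.+1).+1 = p by lia.
have -> : W - (W - p.+1) = p.+1 by lia.
rewrite (accepts_okP _ V HT) eqxx /=; apply.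
by apply: leq_trans HN; rewrite [T.+2 * W]mulSn; lia.
Qed.

Definition start_cell (i : nat) : cell := cell_at (row 0) i.

Lemma helix_start i : i <= W -> helix (W - i) = start_cell i.
Proof.
by move=> Hi; have := @helixE 0 (W - i) (leq_subr _ _); rewrite mul0n add0n subKn.
Qed.

(** Beyond the initial row, every entry is a function of entries with smaller index. *)
Lemma helix_unique N (x : nat -> cell) :
  (forall i, i <= W -> x (W - i) = start_cell i) ->
  (forall n, n < N -> x (n + W.+1) = next_cell (x n.+2) (x n.+1) (x n)) ->
  forall n, n < N + W.+1 -> x n = helix n.
Proof.
move=> H0 HS n; elim/ltn_ind: n => n IH Hn.
have [HnW|HnW] := leqP n W.
  by rewrite -(subKn HnW) H0 ?leq_subr // helix_start ?leq_subr.
rewrite -(subnK HnW) HS; last lia.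
rewrite helix_step !IH //; lia.
Qed.
End Tableau.

(** * Generating the formula by word rewriting *)

Fixpoint rename (s : nat -> nat) (phi : cpformula) : cpformula :=
  match phi with
  | FLe i j => FLe (s i) (s j)
  | FEq i j => FEq (s i) (s j)
  | FAnd p q => FAnd (rename s p) (rename s q)
  | FAll i p => FAll (s i) (rename s p)
  | FEx i p => FEx (s i) (rename s p)
  end.

Lemma rename_table s rows : (forall v, v < first_var -> s v = v) ->
  rename s (table_formula rows) =
  table_formula [seq [seq (s l.1, l.2) | l <- row] | row <- rows].
Proof.
move=> Hs; rewrite /table_formula.
suff H u : u < 10 -> rename s (chain_formula rows u) =
    chain_formula [seq [seq (s l.1, l.2) | l <- row] | row <- rows] u by exact: H.
elim: rows u => [|row rows IH] u Hu /=.
  by rewrite !Hs // (ltn_trans Hu).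
have [Hw _ _] := flip_varP u.
have Er : rename s (foldr (fun l => FAnd (lit_formula l)) (FEq 4 4) row) =
    foldr (fun l => FAnd (lit_formula l)) (FEq 4 4) [seq (s l.1, l.2) | l <- row].
  by elim: row => [|[v []] row IHr] /=; rewrite ?IHr ?(Hs 4, Hs 5, Hs 7, Hs 10, Hs 11).
rewrite IH // Er !Hs //.
  exact: ltn_trans Hu _.
exact: ltn_trans Hw _.
Qed.

Lemma flatmap_cons (T T' : Type) (F : T -> seq T') x u :
  flatten (map F (x :: u)) = F x ++ flatten (map F u).
Proof. by []. Qed.

Section Encode.
Variables (T : Type) (bit : bool -> T).

(** Abstracting over bits and variable codes lets one encoding produce both the words with counter
    markers and the final bit string. *)
Fixpoint encw (ev : nat -> seq T) (phi : cpformula) : seq T :=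
  match phi with
  | FLe i j => map bit [:: false; false; false] ++ ev i ++ ev j
  | FEq i j => map bit [:: false; false; true] ++ ev i ++ ev j
  | FAnd p q => map bit [:: false; true; false] ++ encw ev p ++ encw ev q
  | FAll i p => map bit [:: false; true; true] ++ ev i ++ encw ev p
  | FEx i p => map bit [:: true; false; false] ++ ev i ++ encw ev p
  end.

Lemma eq_encw ev ev' phi : ev =1 ev' -> encw ev phi = encw ev' phi.
Proof.
by move=> E; elim: phi => [i j|i j|p IHp q IHq|i p IHp|i p IHp] /=;
  rewrite ?E ?IHp ?IHq.
Qed.

Lemma flatmap_bits (T' : Type) (F : T -> seq T') (bit' : bool -> T') s :
  (forall b, F (bit b) = [:: bit' b]) -> flatten (map F (map bit s)) = map bit' s.
Proof. by move=> H; elim: s => //= b s ->; rewrite H. Qed.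
End Encode.

Lemma flatmap_cat (T T' : Type) (F : T -> seq T') u v :
  flatten (map F (u ++ v)) = flatten (map F u) ++ flatten (map F v).
Proof. by rewrite map_cat flatten_cat. Qed.

Lemma flatmap_encw (T T' : Type) (bit : bool -> T) (bit' : bool -> T')
    (F : T -> seq T') ev phi :
  (forall b, F (bit b) = [:: bit' b]) ->
  flatten (map F (encw bit ev phi)) =
  encw bit' (fun v => flatten (map F (ev v))) phi.
Proof.
move=> H; elim: phi => [i j|i j|p IHp q IHq|i p IHp|i p IHp] /=;
  by rewrite !H /= flatmap_cat ?IHp ?IHq.
Qed.

Lemma encw_rename s phi :
  encw id (fun v => enc_var (s v)) phi = enc_formula (rename s phi).
Proof.
by elim: phi => [i j|i j|p IHp q IHq|i p IHp|i p IHp] /=; rewrite ?IHp ?IHq.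
Qed.

(** * Alphabet, templates and rewriting rules *)

Section Generator.
Variable M : TM.
Notation cell := (cell M).
Notation blank := (blank M).
Variable D : nat.

(* [LTok None], [LTok (Some false)], [LTok (Some true)] stand for one step of
   the tableau, a blank square and a guessed square. Reading one input bit
   expands index [i] by the binomial formula for [(x + 1) ^ i]. *)
Inductive letter : Type :=
| LInp of bool
| LTok of option bool & 'I_D.+1
| LCell of cell
| LBit of bool
| LPair | LStop | LRecA | LRecU | LGenInit | LGenRun.

Definition letter_code (a : letter) :
    bool + (option bool * 'I_D.+1 + (cell + (bool + bool * option bool))) :=
  match a with
  | LInp b => inl b
  | LTok c i => inr (inl (c, i))
  | LCell s => inr (inr (inl s))
  | LBit b => inr (inr (inr (inl b)))
  | LPair => inr (inr (inr (inr (true, None))))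
  | LStop => inr (inr (inr (inr (true, Some true))))
  | LRecA => inr (inr (inr (inr (true, Some false))))
  | LRecU => inr (inr (inr (inr (false, None))))
  | LGenInit => inr (inr (inr (inr (false, Some true))))
  | LGenRun => inr (inr (inr (inr (false, Some false))))
  end.

Definition letter_decode x : letter :=
  match x with
  | inl b => LInp b
  | inr (inl (c, i)) => LTok c i
  | inr (inr (inl s)) => LCell s
  | inr (inr (inr (inl b))) => LBit b
  | inr (inr (inr (inr (true, None)))) => LPair
  | inr (inr (inr (inr (true, Some true)))) => LStop
  | inr (inr (inr (inr (true, Some false)))) => LRecA
  | inr (inr (inr (inr (false, None)))) => LRecU
  | inr (inr (inr (inr (false, Some true)))) => LGenInit
  | inr (inr (inr (inr (false, Some false)))) => LGenRun
  end.

Lemma letter_codeK : cancel letter_code letter_decode.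
Proof. by case. Qed.

HB.instance Definition _ := Finite.copy letter (can_type letter_codeK).

Definition wd : nat := #|cell|.

Definition shift (a u m : nat) : nat := if m < 3 then m + a else m - 3 + u.

Definition shift_block a u (b : block cell) : block cell :=
  (shift a u (b_own b), map (shift a u) (b_recs b), b_rows b).

Definition rename_var (a u v : nat) : nat :=
  if v < first_var then v else
  first_var + wd * shift a u ((v - first_var) %/ wd) + (v - first_var) %% wd.

Definition bits (s : seq bool) : seq letter := map LBit s.

(* Variables of template records [m < 3] and [m >= 3] are relative to the
   record counters [LRecA] and [LRecU]; [a] and [u] are the current values of
   these counters, in unary behind the letter. *)
Definition var_word (a u v : nat) : seq letter :=
  if v < first_var then bits (enc_var v) else
  let m := (v - first_var) %/ wd in let i := (v - first_var) %% wd in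
  if m < 3 then
    bits (nseq (first_var + wd * m + i) true) ++
    LRecA :: bits (nseq (wd * a) true ++ [:: false])
  else
    bits (nseq (first_var + wd * (m - 3) + i) true) ++
    LRecU :: bits (nseq (wd * u) true ++ [:: false]).

(** Formulas are encoded in prefix notation, so the word of a block ends where the rest of the
    formula has to follow, and blocks compose by concatenation. *)
Definition block_word (a u : nat) (b : block cell) : seq letter :=
  flatten [seq bits [:: true; false; false] ++ var_word a u v
          | v <- rec_vars cell (b_own b)] ++
  bits [:: false; true; false] ++ encw LBit (var_word a u) (block_table b).

Definition run_rows : seq (seq cell) :=
  [seq [:: next_cell t.1.1 t.1.2 t.2; t.1.1; t.1.2; t.2]
  | t <- enum {: cell * cell * cell} & accepts_ok t.1.2 t.2].

Definition run_template : block cell := (3, [:: 3; 2; 1; 0], run_rows).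

Definition guess_ok (c p : cell) : bool :=
  (c.2 == None) && ((p.1 == None) ==> (c.1 == None)).

Definition init_template (g : option cell) : block cell :=
  if g is Some s then (3, [:: 3], [:: [:: s]])
  else (3, [:: 3; 4], [seq [:: t.1; t.2] | t <- enum {: cell * cell} & guess_ok t.1 t.2]).

Inductive effect : Type := Run | Square of option cell.

(** Tokens for steps and blanks always count, which yields [n.+1 ^ i] effects after [n] input bits.
    Guess tokens count only with exponent 0, which yields exactly [n ^ i]: the number of guess
    squares must meet the certificate bound precisely. *)
Definition effect_of (a : letter) : option effect :=
  match a with
  | LTok None _ => Some Run
  | LTok (Some false) _ => Some (Square (Some blank))
  | LTok (Some true) i => if i == 0 :> nat then Some (Square None) else None
  | LCell s => Some (Square (Some s))
  | _ => None
  end.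

(** A new block enters with counters 0 in the pass that raises those of the older ones, so the
    counters number the blocks. [LGenRun] emits behind itself to leave the run blocks in increasing
    order, as the scoping of records demands. *)
Definition apply_effect (x : effect) (b : letter) : seq letter :=
  match x, b with
  | Run, LRecA => LRecA :: bits (nseq wd true)
  | Run, LRecU => LRecU :: bits (nseq wd true)
  | Run, LGenRun => LGenRun :: block_word 0 0 run_template
  | Square _, LRecU => LRecU :: bits (nseq wd true)
  | Square g, LGenInit => block_word 0 0 (init_template g) ++ [:: LGenInit]
  | _, _ => [:: b]
  end.

Definition expand (c : option bool) (i : nat) : seq letter :=
  flatten [seq nseq 'C(i, j) (LTok c (inord j)) | j <- iota 0 i.+1].

Definition gen (a b : letter) : seq letter :=
  match a with
  | LInp x =>
      match b with
      | LTok c i => expand c i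
      | LPair => [:: LCell (Some x, None); LCell (Some x, None); LPair]
      | _ => [:: b]
      end
  | _ => if effect_of a is Some x then apply_effect x b else [:: b]
  end.

Definition raw_letter (a : letter) : seq bool := if a is LBit b then [:: b] else [::].

Notation flatmap F w := (flatten (map F w)).

Lemma bits_cat s t : bits (s ++ t) = bits s ++ bits t.
Proof. exact: map_cat. Qed.

Lemma raw_bits s : flatmap raw_letter (bits s) = s.
Proof. by rewrite (@flatmap_bits _ _ _ _ id) // map_id. Qed.

Lemma apply_effect_bits x s : flatmap (apply_effect x) (bits s) = bits s.
Proof. by apply: flatmap_bits => b; case: x. Qed.

Lemma raw_var_word a u v :
  flatmap raw_letter (var_word a u v) = enc_var (rename_var a u v).
Proof.
rewrite /var_word /rename_var /shift; case: ltnP => Hv; first exact: raw_bits.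
have E n m x : raw_letter x = [::] ->
    flatmap raw_letter (bits (nseq n true) ++ x :: bits (nseq m true ++ [:: false]))
    = enc_var (n + m).
  by move=> Ex; rewrite flatmap_cat /= Ex /= !raw_bits catA -nseqD.
by case: ltnP => Hm; rewrite E // mulnDr; congr enc_var; lia.
Qed.

Lemma run_var_word a u v :
  flatmap (apply_effect Run) (var_word a u v) = var_word a.+1 u.+1 v.
Proof.
rewrite /var_word; case: ltnP => Hv; first exact: apply_effect_bits.
have E n m x : apply_effect Run x = x :: bits (nseq wd true) ->
    flatmap (apply_effect Run) (bits (nseq n true) ++ x :: bits (nseq (wd * m) true ++ [:: false]))
    = bits (nseq n true) ++ x :: bits (nseq (wd * m.+1) true ++ [:: false]).
  move=> Ex; rewrite flatmap_cat flatmap_cons !apply_effect_bits Ex.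
  by rewrite cat_cons -bits_cat catA -nseqD mulnS.
by case: ltnP => Hm; rewrite E.
Qed.

Lemma square_var_word g a u v :
  flatmap (apply_effect (Square g)) (var_word a u v) = var_word a u.+1 v.
Proof.
rewrite /var_word; case: ltnP => Hv; first exact: apply_effect_bits.
case: ltnP => Hm; rewrite flatmap_cat apply_effect_bits /= apply_effect_bits //.
by rewrite -bits_cat catA -nseqD mulnS.
Qed.

Lemma flatmap_flatmap (T1 T2 T3 : Type) (F : T2 -> seq T3) (G : T1 -> seq T2) w :
  flatmap F (flatmap G w) = flatmap (fun x => flatmap F (G x)) w.
Proof. by elim: w => //= x w <-; rewrite flatmap_cat. Qed.

Lemma apply_block_word x a u a' u' b :
  (forall v, flatmap (apply_effect x) (var_word a u v) = var_word a' u' v) ->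
  flatmap (apply_effect x) (block_word a u b) = block_word a' u' b.
Proof.
move=> H; rewrite /block_word !flatmap_cat apply_effect_bits.
rewrite (flatmap_encw (bit' := LBit)); last first.
  by move=> t; case: (x).
rewrite (eq_encw _ _ H); congr (_ ++ _).
elim: (rec_vars _) => //= v vs <-.
by rewrite !flatmap_cat H; case: (x).
Qed.

Lemma wd_gt0 : 0 < wd.
Proof. by apply/card_gt0P; exists blank. Qed.

Lemma rename_rvar a u m (s : cell) :
  rename_var a u (rvar m s) = rvar (shift a u m) s.
Proof.
rewrite /rename_var /rvar -!addnA addKn ltnNge leq_addr /= -/wd !(mulnC wd).
have Hr : enum_rank s < wd by [].
by rewrite divnMDl ?wd_gt0 // divn_small // addn0 modnMDl modn_small.
Qed.

Lemma row_lits_shift a u rs (row : seq cell) :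
  [seq (rename_var a u l.1, l.2) | l <- row_lits rs row] =
  row_lits (map (shift a u) rs) row.
Proof.
rewrite /row_lits; elim: rs row => [|m rs IH] [|s row] //=.
rewrite map_cat IH -map_comp; congr (_ ++ _).
by apply: eq_map => s' /=; rewrite rename_rvar.
Qed.

Lemma enc_block (b : block cell) phi :
  enc_formula (block_formula b phi) =
  flatten [seq [:: true; false; false] ++ enc_var v | v <- rec_vars cell (b_own b)] ++
  [:: false; true; false] ++ enc_formula (block_table b) ++ enc_formula phi.
Proof.
rewrite /block_formula; elim: (rec_vars _) => //= v vs ->.
by rewrite -catA.
Qed.

Lemma raw_block_word a u (b : block cell) phi :
  flatmap raw_letter (block_word a u b) ++ enc_formula phi =
  enc_formula (block_formula (shift_block a u b) phi).
Proof.
rewrite enc_block /block_word !flatmap_cat raw_bits -!catA.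
congr (_ ++ _).
  have -> : rec_vars cell (b_own (shift_block a u b)) =
            map (rename_var a u) (rec_vars cell (b_own b)).
    by rewrite /rec_vars -map_comp; apply: eq_map => s /=; rewrite rename_rvar.
  by elim: (rec_vars _) => //= v vs <-; rewrite flatmap_cat raw_var_word.
congr (_ ++ _); congr (_ ++ _).
rewrite (flatmap_encw (bit' := id)) //.
rewrite (eq_encw _ _ (raw_var_word a u)) encw_rename /block_table rename_table.
  congr (enc_formula (table_formula _)).
  by rewrite -map_comp; apply: eq_map => row /=; rewrite row_lits_shift.
by move=> v Hv; rewrite /rename_var Hv.
Qed.
End Generator.

(** * Effect of the control letters on the body, and its growth *)

Section Run.
Variables (M : TM) (D : nat).
Notation cell := (cell M).
Notation letter := (letter M D).
Notation flatmap F w := (flatten (map F w)).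
Notation step := (rw_step (@gen M D)).

Definition apply_effects (xs : seq (effect M)) (w : seq letter) : seq letter :=
  foldl (fun w x => flatmap (apply_effect x) w) w xs.

Definition control (a : letter) : bool :=
  match a with LTok _ _ | LCell _ | LPair => true | _ => false end.

Lemma gen_controlE a : control a -> forall b,
  gen a b = if effect_of a is Some x then apply_effect x b else [:: b].
Proof. by case: a. Qed.

Lemma gen_control a P : control a -> all control P -> flatmap (gen a) P = P.
Proof.
move=> Ha; elim: P => //= b P IH /andP [Hb /IH ->].
rewrite gen_controlE //.
by case: (effect_of a) => [[|g]|] //; case: b Hb.
Qed.

Lemma step_control a P body : control a -> all control P ->
  step ((a :: P) ++ LStop M D :: body) =
  P ++ LStop M D :: apply_effects (pmap (@effect_of M D) [:: a]) body.
Proof.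
move=> Ha HP; rewrite /rw_step /= flatmap_cat gen_control //; congr (_ ++ _).
have Hid w : flatmap (fun b : letter => [:: b]) w = w by elim: w => //= b w ->.
rewrite flatmap_cons.
rewrite /= [gen a _]gen_controlE // (eq_map (gen_controlE Ha)).
by case: (effect_of a) => [[|g]|] //=; rewrite Hid.
Qed.

(** Control letters do not rewrite one another, so each takes one pass and acts on the body only. *)
Lemma iter_control P body i : all control P -> i <= size P ->
  iter i step (P ++ LStop M D :: body) =
  drop i P ++ LStop M D :: apply_effects (pmap (@effect_of M D) (take i P)) body.
Proof.
elim: i P body => [|i IH] P body HP Hi; first by rewrite drop0 take0.
case: P HP Hi => // a P /andP [Ha HP] Hi.
rewrite iterSr step_control // IH //=; congr (_ ++ _ :: _).
by rewrite /apply_effects -foldl_cat; case: (effect_of a).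
Qed.

Fixpoint init_words (gs : seq (option cell)) : seq letter :=
  if gs is g :: gs' then
    block_word D 0 (size gs') (init_template g) ++ init_words gs'
  else [::].

Definition run_words (N s : nat) : seq letter :=
  flatten [seq block_word D j (j + s) (run_template M) | j <- iota 0 N].

Definition body (pre suf : seq bool) gs N : seq letter :=
  bits M D pre ++ init_words gs ++ [:: LGenInit M D; LGenRun M D] ++
  run_words N (size gs) ++ bits M D suf.

Lemma run_words_run N :
  block_word D 0 0 (run_template M) ++
    flatmap (apply_effect (Run M)) (run_words N 0) = run_words N.+1 0.
Proof.
rewrite /run_words flatmap_flatmap /= (iotaDl 1 0) -map_comp; congr (_ ++ _).
congr flatten; apply: eq_map => j /=.
by rewrite (apply_block_word _ (@run_var_word M D _ _)) !addn0 add1n.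
Qed.

Lemma run_words_square (g : option cell) N s :
  flatmap (apply_effect (Square g)) (run_words N s) = run_words N s.+1.
Proof.
rewrite /run_words flatmap_flatmap; congr flatten; apply: eq_map => j /=.
by rewrite (apply_block_word _ (@square_var_word M D g _ _)) addnS.
Qed.

Lemma run_effects pre suf N :
  apply_effects (nseq N (Run M)) (body pre suf [::] 0) = body pre suf [::] N.
Proof.
elim: N => // N IH; rewrite -addn1 nseqD /apply_effects foldl_cat.
move: IH; rewrite /apply_effects => -> /=; rewrite /body !flatmap_cat.
by rewrite !apply_effect_bits addn1 -run_words_run /= -!catA.
Qed.

Lemma init_words_square (g : option cell) gs :
  flatmap (apply_effect (Square g)) (init_words gs) ++
    block_word D 0 0 (init_template g) = init_words (rcons gs g).
Proof.
elim: gs => [|g' gs IH] /=; first by rewrite cats0.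
rewrite flatmap_cat -catA IH size_rcons.
by rewrite (apply_block_word _ (@square_var_word M D g _ _)).
Qed.

Lemma square_effects pre suf gs N :
  apply_effects (map (@Square M) gs) (body pre suf [::] N) = body pre suf gs N.
Proof.
elim/last_ind: gs => // gs g IH; rewrite map_rcons -cats1 /apply_effects foldl_cat.
move: IH; rewrite /apply_effects => -> /=; rewrite /body !flatmap_cat.
rewrite !apply_effect_bits; congr (_ ++ _).
by rewrite -init_words_square size_rcons run_words_square /= -!catA.
Qed.

Fixpoint init_blocks (gs : seq (option cell)) : seq (block cell) :=
  if gs is g :: gs' then
    shift_block 0 (size gs') (init_template g) :: init_blocks gs'
  else [::].

Definition run_blocks (N s : nat) : seq (block cell) :=
  [seq shift_block j (j + s) (run_template M) | j <- iota 0 N].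

Definition tableau_blocks gs N := init_blocks gs ++ run_blocks N (size gs).

(** In prefix notation the body comes last, so these bits are cut from the encoding of a sample
    formula. *)
Definition prefix_bits : seq bool :=
  take (size (enc_formula (csp_prefix (FEq 4 4))) - size (enc_formula (FEq 4 4)))
       (enc_formula (csp_prefix (FEq 4 4))).

Lemma enc_csp_prefix phi :
  enc_formula (csp_prefix phi) = prefix_bits ++ enc_formula phi.
Proof. by []. Qed.

Lemma raw_body gs N :
  flatmap (@raw_letter M D) (body prefix_bits (enc_formula (FEq 4 4)) gs N) =
  enc_formula (csp_formula (tableau_blocks gs N)).
Proof.
rewrite /csp_formula enc_csp_prefix /body !flatmap_cat !raw_bits.
congr (_ ++ _); rewrite cat0s.
rewrite /csp_body /tableau_blocks foldr_cat.
have -> : flatmap (@raw_letter M D) (run_words N (size gs)) ++ enc_formula (FEq 4 4) =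
    enc_formula (csp_body (run_blocks N (size gs))).
  rewrite /run_words /run_blocks; elim: (iota 0 N) => // j js IH.
  by rewrite /= flatmap_cat -catA IH raw_block_word.
rewrite -/(csp_body (run_blocks _ _)); move: (csp_body _) => phi.
elim: gs => //= g gs IH.
by rewrite flatmap_cat -catA IH raw_block_word.
Qed.

Definition is_slot (a : letter) : bool :=
  match a with LRecA | LRecU => true | _ => false end.
Definition is_gen (a : letter) : bool :=
  match a with LGenInit | LGenRun => true | _ => false end.

Definition block_size : nat :=
  maxn (size (block_word D 0 0 (run_template M)))
       (\max_g size (block_word D 0 0 (@init_template M g))).

Lemma bits_gen s : count is_gen (bits M D s) = 0.
Proof. by elim: s. Qed.
Lemma bits_slot s : count is_slot (bits M D s) = 0.
Proof. by elim: s. Qed.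

Lemma count_encw ev phi : (forall v, count is_gen (ev v) = 0) ->
  count is_gen (encw (@LBit M D) ev phi) = 0.
Proof.
move=> H; elim: phi => [i j|i j|p IHp q IHq|i p IHp|i p IHp] /=;
  by rewrite count_cat ?IHp ?IHq ?H.
Qed.

Lemma count_block_word a u b : count is_gen (block_word D a u b) = 0.
Proof.
have Hv v : count is_gen (@var_word M D a u v) = 0.
  rewrite /var_word; case: ifP => _; first exact: bits_gen.
  by case: ifP => _; rewrite count_cat /= !bits_gen.
rewrite /block_word !count_cat bits_gen count_encw // !addn0.
by elim: (rec_vars _ _) => //= v vs; rewrite count_cat => ->; rewrite addn0 Hv.
Qed.

Lemma apply_effect_letter (x : effect M) (a : letter) :
  [/\ count is_gen (apply_effect x a) = is_gen a,
      count is_slot (apply_effect x a) <= is_slot a + block_size * is_gen a &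
      size (apply_effect x a) <= 1 + wd M * is_slot a + block_size * is_gen a].
Proof.
have Hr : size (block_word D 0 0 (run_template M)) <= block_size.
  exact: leq_maxl.
have Hi g : size (block_word D 0 0 (@init_template M g)) <= block_size.
  by apply: leq_trans (leq_maxr _ _); apply: (leq_bigmax g).
have Hs : size (bits M D (nseq (wd M) true)) = wd M by rewrite size_map size_nseq.
have Hc a0 u b : count is_slot (block_word D a0 u b) <= size (block_word D a0 u b).
  exact: count_size.
have Hid : apply_effect x a = [:: a] ->
  [/\ count is_gen (apply_effect x a) = is_gen a,
      count is_slot (apply_effect x a) <= is_slot a + block_size * is_gen a &
      size (apply_effect x a) <= 1 + wd M * is_slot a + block_size * is_gen a].
  by move=> ->; rewrite /= !addn0 leq_addr -addnA leq_addr.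
case: a x Hid => [b|c i|s|b| | | | | |] [|g] Hid; try exact: Hid erefl.
- by rewrite /= bits_gen bits_slot Hs; split=> //; lia.
- by rewrite /= bits_gen bits_slot Hs; split=> //; lia.
- by rewrite /= bits_gen bits_slot Hs; split=> //; lia.
- move: (Hc 0 0 (init_template g)) (Hi g) (count_block_word 0 0 (init_template g)).
  rewrite /=; move: (block_word _ _ _ _) => w h1 h2 h3.
  by rewrite !count_cat size_cat h3 /=; split=> //; lia.
- rewrite /= count_block_word /= muln1 add0n muln0 addn0 add1n ltnS.
  by split=> //; rewrite (leq_trans (Hc _ _ _)).
Qed.

Lemma apply_effect_word (x : effect M) (w : seq letter)
    (w' := flatmap (apply_effect x) w) :
  [/\ count is_gen w' = count is_gen w,
      count is_slot w' <= count is_slot w + block_size * count is_gen w &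
      size w' <= size w + wd M * count is_slot w + block_size * count is_gen w].
Proof.
rewrite {}/w'; elim: w => [|a w [H1 H2 H3]] //.
have [E1 E2 E3] := apply_effect_letter x a.
rewrite flatmap_cons !count_cat size_cat /= E1 H1; split=> //.
  by move: E2 H2; rewrite mulnDr; lia.
by move: E3 H3; rewrite !mulnDr; lia.
Qed.

(** The number of generators never changes, so each effect adds a bounded number of counter markers
    and lengthens the word by a constant per marker and generator. Growth is quadratic in the number
    of effects, not exponential. *)
Lemma apply_effects_word xs (w : seq letter) (k := size xs)
    (s := count is_slot w) (g := count is_gen w) (w' := apply_effects xs w) :
  [/\ count is_gen w' = g, count is_slot w' <= s + k * (block_size * g) &
      size w' <= size w + k * (wd M * (s + k * (block_size * g)) + block_size * g)].
Proof.
rewrite {}/w' {}/s {}/g {}/k; elim/last_ind: xs => [|xs x [H1 H2 H3]].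
  by rewrite /= !addn0.
rewrite size_rcons /apply_effects -cats1 foldl_cat -/(apply_effects _ _) /=.
have [E1 E2 E3] := apply_effect_word x (apply_effects xs w).
move: E1 E2 E3; rewrite H1 => E1 E2 E3.
set k := size xs in H2 H3 *; set g := count is_gen w in H1 H2 H3 E1 E2 E3 *.
have H2' : count is_slot w + k * (block_size * g) <=
           count is_slot w + k.+1 * (block_size * g).
  by rewrite leq_add2l leq_mul.
split; first exact: E1.
  by rewrite (leq_trans E2) // mulSn addnCA addnC leq_add2l.
have h1 : wd M * count is_slot (apply_effects xs w) <=
          wd M * (count is_slot w + k.+1 * (block_size * g)).
  by rewrite leq_mul // (leq_trans H2).
have h2 : k * (wd M * (count is_slot w + k * (block_size * g)) + block_size * g) <=
          k * (wd M * (count is_slot w + k.+1 * (block_size * g)) + block_size * g).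
  by rewrite leq_mul // leq_add2r leq_mul.
apply: leq_trans E3 _.
rewrite -[X in X <= _]addnA mulSn [X in _ <= _ + X]addnC [X in _ <= X]addnA.
apply: leq_add.
  by apply: leq_trans H3 _; rewrite leq_add2l.
by rewrite leq_add2r.
Qed.
End Run.

(** * Consuming the input bits *)

Section Input.
Variables (M : TM) (D : nat).
Notation cell := (cell M).
Notation letter := (letter M D).
Notation flatmap F w := (flatten (map F w)).
Notation step := (rw_step (@gen M D)).

(** Input bits rewrite each letter independently of its neighbours, so the outcome of a whole input
    can be described letter by letter. *)
Fixpoint feed (w : seq bool) (b : letter) : seq letter :=
  if w is a :: w' then flatmap (feed w') (gen (LInp M D a) b) else [:: b].

Lemma iter_input w rest i : i <= size w ->
  iter i step (map (@LInp M D) w ++ rest) =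
  map (@LInp M D) (drop i w) ++ flatmap (feed (take i w)) rest.
Proof.
elim: i w rest => [|i IH] w rest Hi.
  by rewrite drop0 take0 /=; congr (_ ++ _); elim: rest => //= b r <-.
case: w Hi => // a w Hi; rewrite iterSr.
have -> : step (map (@LInp M D) (a :: w) ++ rest) =
          map (@LInp M D) w ++ flatmap (gen (LInp M D a)) rest.
  rewrite /rw_step /= flatmap_cat; congr (_ ++ _).
  by elim: w {IH Hi} => //= b w ->.
by rewrite IH // flatmap_flatmap.
Qed.

Lemma feed_inert w b : (forall a, gen (LInp M D a) b = [:: b]) -> feed w b = [:: b].
Proof.
move=> H; elim: w => // a w IH.
by change (flatmap (feed w) (gen (LInp M D a) b) = [:: b]); rewrite H /= IH.
Qed.

Lemma feed_body w pre suf : flatmap (feed w) (body D pre suf [::] 0) =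
  body D pre suf ([::] : seq (option cell)) 0.
Proof.
have Hb s : flatmap (feed w) (bits M D s) = bits M D s.
  by apply: flatmap_bits => b; apply: feed_inert.
by rewrite /body !flatmap_cat !Hb /= !feed_inert.
Qed.

Definition square_bit (b : bool) : cell := (Some b, None).

Lemma feed_pair w : feed w (LPair M D) =
  flatten [seq [:: LCell D (square_bit b); LCell D (square_bit b)] | b <- w] ++
  [:: LPair M D].
Proof. by elim: w => //= a w ->; rewrite !feed_inert //= cats0. Qed.

Lemma pmap_flatten (T X : Type) (e : T -> option X) ss :
  pmap e (flatten ss) = flatten (map (pmap e) ss).
Proof. by elim: ss => //= s ss <-; rewrite pmap_cat. Qed.

Lemma flatten_nseq (X : Type) k n (x : X) :
  flatten (nseq k (nseq n x)) = nseq (k * n) x.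
Proof. by elim: k => //= k ->; rewrite mulSn nseqD. Qed.

Lemma flatten_nseqs (X I : Type) (g : I -> nat) (x : X) s :
  flatten [seq nseq (g i) x | i <- s] = nseq (\sum_(i <- s) g i) x.
Proof. by elim: s => [|i s IH]; rewrite ?big_nil ?big_cons //= IH nseqD. Qed.

(** By the binomial formula each input bit adds one to the base [m]. Steps and blanks start from
    base 1, guesses from base 0, as [0 ^ i] is 1 only at [i = 0]. *)
Lemma feed_token (X : Type) (e : letter -> option X) (x : X) m c w (i : 'I_D.+1) :
  (forall i, pmap e [:: LTok M c i] = nseq (m ^ i) x) ->
  pmap e (feed w (LTok M c i)) = nseq ((m + size w) ^ i) x.
Proof.
move=> He; elim: w i => [|a w IH] i; first by rewrite addn0 -He.
rewrite [feed _ _]/= /expand flatmap_flatmap pmap_flatten -map_comp.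
have E j : j \in iota 0 i.+1 ->
    (pmap e \o (fun j => flatmap (feed w) (nseq 'C(i, j) (LTok M c (inord j))))) j
    = nseq ('C(i, j) * (m + size w) ^ j) x.
  rewrite mem_iota /= add0n => Hj.
  have Hj' : j < D.+1 by apply: leq_trans Hj _.
  by rewrite map_nseq pmap_flatten map_nseq IH inordK // flatten_nseq.
rewrite (iffLR (eq_in_map _ _ _) E) flatten_nseqs; congr nseq.
rewrite [size _]/= addnS -[(m + _).+1]add1n expnDn -[iota 0 i.+1]/(index_iota 0 i.+1) big_mkord.
by apply: eq_bigr => j _; rewrite exp1n mul1n.
Qed.

Lemma feed_run w (i : 'I_D.+1) :
  pmap (@effect_of M D) (feed w (LTok M None i)) = nseq ((size w).+1 ^ i) (Run M).
Proof. by rewrite (@feed_token _ _ (Run M) 1) // => j; rewrite exp1n. Qed.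

Lemma feed_blank w (i : 'I_D.+1) :
  pmap (@effect_of M D) (feed w (LTok M (Some false) i)) =
  nseq ((size w).+1 ^ i) (Square (Some (blank M))).
Proof. by rewrite (@feed_token _ _ (Square (Some (blank M))) 1) // => j; rewrite exp1n. Qed.

Lemma feed_guess w (i : 'I_D.+1) :
  pmap (@effect_of M D) (feed w (LTok M (Some true) i)) =
  nseq (size w ^ i) (Square (None : option cell)).
Proof.
rewrite (@feed_token _ _ (Square (None : option cell)) 0) // => j /=.
by case: (nat_of_ord j) => [|k] //=; rewrite exp0n.
Qed.

Lemma size_feed w b : size (feed w b) <= (size w).+1 ^ D + (2 * size w + 1).
Proof.
have H1 : 0 < (size w).+1 ^ D by rewrite expn_gt0.
case: b => [b|c i|s|b| | | | | |]; try by rewrite feed_inert //=; lia.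
  have := @feed_token _ (fun=> Some tt) tt 1 c w i (fun j => _).
  rewrite add1n => /(_ _)/(congr1 size); rewrite size_nseq size_pmap => E.
  have {E} <- : (size w).+1 ^ i = size (feed w (LTok M c i)).
    rewrite -E => [|j]; last by rewrite exp1n.
    by rewrite (eq_count (a2 := predT)) ?count_predT.
  by apply: leq_trans (leq_addr _ _); rewrite leq_pexp2l // -ltnS.
rewrite feed_pair size_cat /=.
have -> : size (flatten [seq [:: LCell D (square_bit b); LCell D (square_bit b)]
                        | b <- w]) = 2 * size w.
  by elim: w {H1} => //= a w ->; lia.
lia.
Qed.

Lemma control_feed w b : control b -> all (@control M D) (feed w b).
Proof.
elim: w b => [|a w IH] b Hb; first by rewrite /= Hb.
change (is_true (all (@control M D) (flatmap (feed w) (gen (LInp M D a) b)))).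
have : all (@control M D) (gen (LInp M D a) b).
  case: b Hb => // c i _ /=; rewrite /expand; apply/allP => x.
  by case/flattenP => _ /mapP [j _ ->] /nseqP [->].
by elim: (gen _ _) => //= x xs IHx /andP [Hx /IHx]; rewrite all_cat IH.
Qed.
End Input.

(** * The reduction and its running time *)

Section Reduction.
Variables (M : TM) (cn K1 d1 K2 d2 : nat).
Let D := cn + d1 + d2.
Notation letter := (letter M D).
Notation flatmap F w := (flatten (map F w)).
Notation step := (rw_step (@gen M D)).

Definition tokens (c : option bool) (d K : nat) : seq letter :=
  nseq K (LTok M c (inord d)).

(** Giving the initial head a blank square of its own keeps states off the input squares, so a bit
    becomes the same cell at every position. *)
Definition start_square : cell M := (None, Some None).

(** Steps precede squares because a step would also shift the squares already emitted. The guess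
    tokens, [cn] with exponent [cn] and [cn] with exponent 0, amount to [poly_bound cn]; the two
    fixed bits are the separator of [pair_enc]. *)
Definition control_word : seq letter :=
  tokens None d2 K2 ++ tokens (Some false) d1 K1 ++
  [:: LCell D start_square; LPair M D; LCell D (square_bit M false);
      LCell D (square_bit M true)] ++
  tokens (Some true) cn cn ++ tokens (Some true) 0 cn ++
  tokens (Some false) d1 K1.

Definition body0 : seq letter :=
  body D prefix_bits (enc_formula (FEq 4 4)) [::] 0.

Definition tail_word : seq letter := control_word ++ LStop M D :: body0.

Definition padding (n : nat) := K1 * n.+1 ^ d1.
Definition run_length (n : nat) := K2 * n.+1 ^ d2.

Definition squares (w : seq bool) : seq (option (cell M)) :=
  nseq (padding (size w)) (Some (blank M)) ++ Some start_square ::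
  map (fun b => Some (square_bit M b)) (flatten [seq [:: b; b] | b <- w] ++ [:: false; true]) ++
  nseq (poly_bound cn (size w)) None ++ nseq (padding (size w)) (Some (blank M)).

Definition reduction (w : seq bool) : seq bool :=
  enc_formula (csp_formula (tableau_blocks (squares w) (run_length (size w)))).

Lemma feed_tokens c d K w x k : d <= D ->
  (forall i : 'I_D.+1, pmap (@effect_of M D) (feed w (LTok M c i)) = nseq (k ^ i) x) ->
  pmap (@effect_of M D) (flatmap (feed w) (tokens c d K)) = nseq (K * k ^ d) x.
Proof.
move=> Hd H; rewrite /tokens map_nseq pmap_flatten map_nseq H flatten_nseq.
by rewrite inordK.
Qed.

Lemma control_effects w :
  pmap (@effect_of M D) (flatmap (feed w) control_word) =
  nseq (run_length (size w)) (Run M) ++ map (@Square M) (squares w).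
Proof.
have Hcat u v : pmap (@effect_of M D) (flatmap (feed w) (u ++ v)) =
    pmap (@effect_of M D) (flatmap (feed w) u) ++
    pmap (@effect_of M D) (flatmap (feed w) v) by rewrite flatmap_cat pmap_cat.
rewrite /control_word !Hcat.
rewrite (feed_tokens _ _ (feed_run M w)); last by rewrite /D; lia.
rewrite (feed_tokens _ _ (feed_blank M w)); last by rewrite /D; lia.
rewrite (feed_tokens (d := cn) _ _ (feed_guess M w)); last by rewrite /D; lia.
rewrite (feed_tokens (d := 0) _ _ (feed_guess M w)) // expn0 muln1.
congr (_ ++ _).
rewrite /squares map_cat !map_nseq; congr (_ ++ _).
rewrite [flatmap _ (_ :: _)]/= feed_pair !feed_inert //.
rewrite map_cons !map_cat !map_nseq /poly_bound nseqD -!catA.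
rewrite /= ; congr (_ :: _); rewrite -map_comp pmap_cat /= -!catA /=.
by congr (_ ++ _); elim: w {Hcat} => //= b w ->.
Qed.

Lemma reduction_poly_computable : poly_computable reduction.
Proof.
pose S n := n.+1 ^ D + (2 * n + 1).
pose C n := size control_word * S n.
pose k n := n + C n.
pose B n := n + size tail_word * S n + (C n + 1 + (size body0 + C n *
  (wd M * (C n * (block_size M D * 2)) + block_size M D * 2))).
have pc K : polynomial (fun=> K) := polynomial_const K.
have pS : polynomial S.
  apply: polynomial_add.
    by exists 1, D => n; rewrite mul1n.
  apply: polynomial_add (pc 1); exact: polynomial_mul (pc 2) polynomial_id.
have pC : polynomial C by apply: polynomial_mul (pc _) (pS).
have pk : polynomial k by apply: polynomial_add polynomial_id (pC).
have pB : polynomial B.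
  apply: polynomial_add.
    apply: polynomial_add polynomial_id _; exact: polynomial_mul (pc _) pS.
  apply: polynomial_add; first exact: polynomial_add pC (pc 1).
  apply: polynomial_add (pc _) _; apply: polynomial_mul (pC) _.
  apply: polynomial_add _ (pc _); apply: polynomial_mul (pc _) _.
  exact: polynomial_mul pC (pc _).
apply: (@rewriting_poly_computable _ (@gen M D) (pred1 (LStop M D))
  (@raw_letter M D) (@LInp M D) tail_word reduction k B pk pB) => w w0.
set P := flatmap (feed w) control_word.
have HS u (v : seq letter) : size (flatmap (feed u) v) <= size v * S (size u).
  elim: v => //= b v IH; rewrite size_cat mulSn leq_add //.
  exact: size_feed.
have HP : size P <= C (size w) by apply: HS.
have HcP : all (@control M D) P.
  apply/allP => a /flattenP [_ /mapP [b Hb ->]]; apply/allP.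
  apply: control_feed; apply: (allP _ _ Hb) => {Hb}.
  by rewrite /control_word !all_cat /tokens !all_nseq /= !orbT.
have E1 : iter (size w) step w0 = P ++ LStop M D :: body0.
  rewrite /w0 iter_input // drop_size take_size [map _ [::]]/= cat0s.
  by rewrite /tail_word flatmap_cat flatmap_cons feed_inert // /body0 feed_body.
have E2 i : i <= size P -> iter (i + size w) step w0 =
    drop i P ++ LStop M D :: apply_effects (pmap (@effect_of M D) (take i P)) body0.
  by move=> Hi; rewrite iterD E1 iter_control.
exists (size P + size w), (LStop M D),
  (apply_effects (pmap (@effect_of M D) P) body0).
split.
- by rewrite addnC leq_add2l.
- by rewrite E2 // drop_size take_size.
- exact: eqxx.
- have Ecat xs ys (v : seq letter) :
    apply_effects (xs ++ ys) v = apply_effects ys (apply_effects xs v).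
    exact: foldl_cat.
  by rewrite /P control_effects Ecat /body0 run_effects square_effects raw_body.
split=> i Hi.
  have [Hiw|Hiw] := ltnP i (size w).
    rewrite /w0 iter_input 1?ltnW //.
    rewrite (drop_nth false) //=.
    by eexists; eexists; split; first reflexivity.
  rewrite -(subnK Hiw) E2; last by rewrite leq_subLR addnC ltnW.
  have Hi' : i - size w < size P by rewrite ltn_subLR // addnC.
  rewrite (drop_nth (LStop M D)) //=.
  eexists; eexists; split; first reflexivity.
  have := allP HcP _ (mem_nth (LStop M D) Hi').
  by apply: contraL => /eqP ->.
have [Hiw|Hiw] := leqP i (size w).
  apply: leq_trans (leq_addr _ _).
  rewrite /w0 iter_input // size_cat size_map size_drop leq_add ?leq_subr //.
  apply: leq_trans (HS _ _) _; rewrite leq_mul // /S size_take_min.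
  have Hm := geq_minr i (size w).
  apply: leq_add; last by lia.
  by case: (D) => // d; rewrite leq_exp2r // ltnS.
apply: leq_trans (leq_addl _ _).
rewrite -(subnK (ltnW Hiw)) E2; last by rewrite leq_subLR addnC.
set j := i - size w.
have [_ _ H3] := apply_effects_word (pmap (@effect_of M D) (take j P)) body0.
have Hs : count (@is_slot M D) body0 = 0.
  by rewrite /body0 /body !count_cat !bits_slot.
have Hg : count (@is_gen M D) body0 = 2.
  by rewrite /body0 /body !count_cat !bits_gen.
have Hk : size (pmap (@effect_of M D) (take j P)) <= C (size w).
  rewrite size_pmap (leq_trans (count_size _ _)) // size_take_min.
  by rewrite (leq_trans (geq_minr _ _)).
rewrite Hs Hg add0n in H3.
rewrite size_cat [size (_ :: _)]/= addn1 addnS -addSn; apply: leq_add.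
  by rewrite ltnS size_drop (leq_trans (leq_subr _ _)).
apply: leq_trans H3 _; rewrite leq_add2l leq_mul //.
by rewrite leq_add2r leq_mul // leq_mul.
Qed.
End Reduction.

(** * Correctness of the reduction *)

Lemma enc_var_inj i j s t :
  nseq i true ++ false :: s = nseq j true ++ false :: t -> i = j /\ s = t.
Proof.
by elim: i j => [|i IH] [|j] //= [] // /IH [-> ->].
Qed.

(** The remainders [s] and [t] are there for the induction: the second conjunct starts wherever the
    first one ends. *)
Lemma enc_formula_prefix p q s t :
  enc_formula p ++ s = enc_formula q ++ t -> p = q /\ s = t.
Proof.
elim: p q s t => [i j|i j|p1 IH1 p2 IH2|i p IH|i p IH]
  [i' j'|i' j'|q1 q2|i' q|i' q] s t //= [] //; rewrite -!catA.
- by case/enc_var_inj => -> /enc_var_inj [-> ->].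
- by case/enc_var_inj => -> /enc_var_inj [-> ->].
- by case/IH1 => -> /IH2 [-> ->].
- by case/enc_var_inj => -> /IH [-> ->].
- by case/enc_var_inj => -> /IH [-> ->].
Qed.

Lemma enc_formula_inj : injective enc_formula.
Proof.
move=> p q E; have [] := @enc_formula_prefix p q [::] [::] => //.
by rewrite E.
Qed.

Lemma MC_bowtie_csp (S : finType) (s0 : S) (bs : seq (block S)) :
  scoped [::] bs ->
  MC_bowtie (enc_formula (csp_formula bs)) <-> exists x, all (satisfies x) bs.
Proof.
move=> Hsc; split.
  by case=> phi [/enc_formula_inj <- [_ H]]; apply: csp_sound H.
by move=> [x Hx]; exists (csp_formula bs); split=> //; split;
  [apply: csp_sentence|apply: csp_complete Hx].
Qed.

(** * Meaning and scoping of the tableau blocks *)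

Section TableauBlocks.
Variable M : TM.
Notation cell := (cell M).

Lemma satisfies_run (x : nat -> cell) j s :
  satisfies x (shift_block j (j + s) (run_template M)) =
  (x (j + s) == next_cell (x j.+2) (x j.+1) (x j)) && accepts_ok (x j.+1) (x j).
Proof.
rewrite /satisfies /= /shift /= subnn add0n add2n add1n.
apply/mapP/andP => [[[[l c] r]]|[/eqP E H]].
  by rewrite mem_filter /= => /andP [H _] [-> -> -> ->].
exists (x j.+2, x j.+1, x j); last by rewrite /= E.
by rewrite mem_filter /= H mem_enum.
Qed.

Definition square_ok (x : nat -> cell) (k : nat) (g : option cell) : bool :=
  if g is Some s then x k == s else guess_ok (x k) (x k.+1).

Lemma satisfies_init (x : nat -> cell) k g :
  satisfies x (shift_block 0 k (init_template g)) = square_ok x k g.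
Proof.
case: g => [s|]; rewrite /satisfies /= /shift /= subnn add0n.
  by rewrite inE eqseq_cons andbT.
have -> : 4 - 3 + k = k.+1 by [].
apply/mapP/idP => [[[c p]]|H].
  by rewrite mem_filter /= => /andP [H _] [-> ->].
by exists (x k, x k.+1); rewrite // mem_filter /= H mem_enum.
Qed.

Lemma satisfies_tableau (x : nat -> cell) gs N :
  reflect ((forall i, i < size gs -> square_ok x (size gs - i.+1) (nth None gs i)) /\
     forall j, j < N -> x (j + size gs) = next_cell (x j.+2) (x j.+1) (x j) /\
                        accepts_ok (x j.+1) (x j))
    (all (satisfies x) (tableau_blocks gs N)).
Proof.
rewrite /tableau_blocks all_cat.
have -> : all (satisfies x) (run_blocks M N (size gs)) =
  all (fun j => (x (j + size gs) == next_cell (x j.+2) (x j.+1) (x j)) &&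
                accepts_ok (x j.+1) (x j)) (iota 0 N).
  by rewrite all_map; apply: eq_all => j; rewrite /= satisfies_run.
have Hi : reflect (forall i, i < size gs -> square_ok x (size gs - i.+1) (nth None gs i))
    (all (satisfies x) (init_blocks gs)).
  elim: gs => [|g gs IH] /=; first by left.
  rewrite satisfies_init; apply: (iffP andP) => [[H0 /IH H] [|i] Hi|H].
  - by rewrite subSS subn0.
  - exact: H.
  split; first by have := H 0 isT; rewrite subSS subn0.
  by apply/IH => i Hi; apply: (H i.+1).
apply: (iffP andP) => [[/Hi H1 /allP H2]|[H1 H2]]; split=> //.
- move=> j Hj; have := H2 j; rewrite mem_iota add0n Hj.
  by move=> /(_ isT) /andP [/eqP].
- exact/Hi.
apply/allP => j; rewrite mem_iota add0n => /H2 [-> ->].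
by rewrite eqxx.
Qed.

(** When block [a] is reached, the declared records are those below [a + s]; [2 < s] covers the
    three that it reads. *)
Lemma scoped_run D N a s : 2 < s -> (forall i, (i \in D) = (i < a + s)) ->
  scoped D [seq shift_block j (j + s) (run_template M) | j <- iota a N].
Proof.
move=> Hs; elim: N a D => //= N IH a D HD.
rewrite /b_own /b_recs /b_rows /= /shift /= !inE !HD.
apply/and4P; split.
- by rewrite subnn add0n -leqNgt.
- by rewrite subnn add0n eqxx; lia.
- by rewrite all_map; apply/allP.
apply: IH => i; rewrite inE HD subnn add0n; lia.
Qed.

(** Squares are declared with falling indices, so a guess square finds its left neighbour, one index
    higher, declared already unless it comes first. *)
Lemma scoped_init D (gs : seq (option cell)) bs :
  (forall i, i \in D -> size gs <= i) ->
  (ohead gs == Some None -> size gs \in D) ->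
  (forall D', (forall i, (i \in D') = (i < size gs) || (i \in D)) -> scoped D' bs) ->
  scoped D (init_blocks gs ++ bs).
Proof.
elim: gs D => [|g gs IH] D /= HD H0 Hbs; first exact: Hbs.
have Hn : size gs \notin D by apply/negP => /HD; rewrite ltnn.
have Eo : b_own (shift_block 0 (size gs) (init_template g)) = size gs.
  by case: (g).
rewrite Eo; apply/and4P; split=> //.
- case: g H0 {Eo} => [s|] H0; rewrite /b_recs /shift_block /= /shift /=.
    by rewrite inE subnn add0n eqxx.
  by rewrite !inE subnn add0n eqxx H0 // orbT.
- case: g {H0 Eo} => [s|] //; rewrite /b_rows /= all_map.
  by apply/allP.
apply: IH.
- by move=> i; rewrite inE => /orP [/eqP ->|/HD /ltnW].
- by rewrite mem_head.
move=> D' HD'; apply: Hbs => i; rewrite HD' inE /=; lia.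
Qed.

Lemma scoped_tableau (gs : seq (option cell)) N :
  2 < size gs -> ohead gs != Some None -> scoped [::] (tableau_blocks gs N).
Proof.
move=> Hs H0; apply: scoped_init => //; first by move/negP: H0.
by move=> D HD; apply: scoped_run => // i; rewrite HD orbF add0n.
Qed.

End TableauBlocks.

Lemma poly_bound_mono c m n : m <= n -> poly_bound c m <= poly_bound c n.
Proof.
move=> H; rewrite /poly_bound leq_add2r leq_mul2l.
by case: (posnP c) => [->//|Hc]; rewrite leq_exp2r // H orbT.
Qed.

Lemma polynomial_poly_bound c f :
  polynomial f -> polynomial (fun n => poly_bound c (f n)).
Proof.
move=> Hf; apply: polynomial_add (polynomial_const c).
by apply: polynomial_mul (polynomial_const c) _; apply: polynomial_exp.
Qed.

Lemma tm_run_halted M t t' w : t <= t' -> tm_halt M (c_st (tm_run M t w)) ->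
  tm_run M t' w = tm_run M t w.
Proof.
move=> Ht H; rewrite -(subnKC Ht) tm_run_add; elim: (t' - t) => //= k ->.
by case: (tm_run M t w) H => /= ? ? ? ? ->.
Qed.

(** [read_bits] stops at the first blank, which loses nothing if only blanks follow; [guess_ok]
    ensures this for the guessed squares. *)
Lemma nth_read_bits (s : seq Sym) k :
  (forall i, i.+1 < size s -> nth None s i = None -> nth None s i.+1 = None) ->
  nth None (map Some (read_bits s)) k = nth None s k.
Proof.
elim: s k => [|[b|] s IH] k H /=; first by rewrite !nth_nil.
  by case: k => //= k; apply: IH => i; apply: (H i.+1).
have H0 i : nth None (None :: s) i = None.
  elim: i => // i IHi; have [Hi|Hi] := ltnP i.+1 (size (None :: s)).
    exact: H.
  by rewrite nth_default.
by rewrite nth_nil; apply/esym; apply: (H0 k).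
Qed.

Lemma size_read_bits s : size (read_bits s) <= size s.
Proof. by elim: s => //= -[b|] s IH. Qed.

Lemma size_double (w : seq bool) : size (flatten [seq [:: b; b] | b <- w]) = 2 * size w.
Proof. by elim: w => //= b w ->; lia. Qed.

(** * Satisfying assignments and accepting certificates *)

Section Correctness.
Variables (M : TM) (cn K1 d1 K2 d2 : nat) (w : seq bool) (T : nat).
Notation cell := (cell M).
Let n := size w.
Let B := padding K1 d1 n.
Let N := run_length K2 d2 n.
Let L := poly_bound cn n.
Let gs := squares M cn K1 d1 w.
Let zw := flatten [seq [:: b; b] | b <- w] ++ [:: false; true].
Let W := B + (2 * n + 2 + (L + B)).
Hypothesis HB : T + 3 < B.
Hypothesis HN : T.+2 * W <= N.
Hypothesis HT : forall y, size y <= L ->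
  tm_halt M (c_st (tm_run M T (pair_enc w y))).

Lemma size_zw : size zw = 2 * n + 2.
Proof. by rewrite size_cat size_double. Qed.

Lemma size_squares : size gs = W.+1.
Proof.
rewrite /gs /squares !size_cat /= !size_cat size_map !size_nseq -/zw size_zw.
by rewrite addnS.
Qed.

Lemma nth_squares i : i <= W -> nth None gs i =
  if i < B then Some (blank M) else if i == B then Some (start_square M) else
  if i - B.+1 < size zw then Some (square_bit M (nth false zw (i - B.+1))) else
  if i - B.+1 - size zw < L then None else Some (blank M).
Proof.
move=> Hi; rewrite /gs /squares nth_cat size_nseq -/B.
case: ltnP => H1; first by rewrite nth_nseq H1.
case: eqP => [->|H2]; first by rewrite subnn.
have -> : i - B = (i - B.+1).+1 by lia.
rewrite /= nth_cat size_map -/zw; case: ltnP => H3.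
  by rewrite (nth_map false).
rewrite nth_cat size_nseq -/n -/L; case: ltnP => H4.
  by rewrite nth_nseq H4.
rewrite nth_nseq -/B ifT //; move: Hi H1 H2 H3 H4; rewrite /W size_zw.
by move: (B) (L) => B' L'; lia.
Qed.

Notation start y := (@start_cell M (pair_enc w y) B).

Lemma start_blank y i : i < B -> start y i = blank M.
Proof.
by move=> Hi; rewrite /start_cell /cell_at /= /start_tape ltn_eqF // ifN // -leqNgt ltnW.
Qed.

Lemma start_start y : start y B = start_square M.
Proof. by rewrite /start_cell /cell_at /= /start_tape ltnn eqxx. Qed.

Lemma start_input y i : B < i ->
  start y i = (nth None (map Some (zw ++ y)) (i - B.+1), None).
Proof.
move=> Hi; rewrite /start_cell /cell_at /= /start_tape Hi gtn_eqF //.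
by rewrite /pair_enc catA.
Qed.

Lemma start_word y i : B < i -> i - B.+1 < size zw ->
  start y i = square_bit M (nth false zw (i - B.+1)).
Proof.
move=> Hi Hz; rewrite start_input // (nth_map false) ?nth_cat ?Hz //.
by rewrite size_cat (leq_trans Hz) // leq_addr.
Qed.

Lemma start_guess y i : B < i -> size zw <= i - B.+1 ->
  start y i = (nth None (map Some y) (i - B.+1 - size zw), None).
Proof.
move=> Hi Hz; rewrite start_input // map_cat nth_cat size_map.
by rewrite ltnNge Hz.
Qed.

Lemma helix_bound y : size y <= L ->
  B.+1 + T + size (pair_enc w y) + 2 < W.
Proof.
rewrite /pair_enc catA size_cat -/zw size_zw /W; move: HB; move: (B) (L) => B' L'.
lia.
Qed.

Lemma reduction_complete y : size y <= L ->
  tm_output (tm_run M T (pair_enc w y)) == [:: true] ->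
  exists x, all (satisfies x) (tableau_blocks gs N).
Proof.
move=> Hy Hout; have HW := helix_bound Hy; have Hhalt := HT Hy.
have HB' : T.+1 < B by lia.
exists (@helix M (pair_enc w y) B W); apply/satisfies_tableau; split.
  rewrite size_squares => i; rewrite ltnS subSS => Hi.
  rewrite /square_ok nth_squares // (helix_start Hhalt HB' HW) //.
  case: ltnP => H1; first by rewrite start_blank.
  case: eqP => [->|H2]; first by rewrite start_start.
  case: ltnP => H3; first by rewrite start_word //; lia.
  have Hi1 : (W - i).+1 = W - i.-1 by lia.
  rewrite Hi1 (helix_start Hhalt HB' HW); last by lia.
  rewrite start_guess; try lia.
  case: ltnP => H4; last first.
    by rewrite nth_default // size_map (leq_trans Hy).
  have Hsz := size_zw.
  (* The left neighbour of the first guess square belongs to the input word and is never blank. *)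
  have [Hz|Hz] := ltnP (i.-1 - B.+1) (size zw).
    by rewrite start_word //; lia.
  rewrite start_guess //; last by lia.
  rewrite /guess_ok /=.
  apply/implyP => /eqP E.
  have : size y <= i.-1 - B.+1 - size zw.
    rewrite leqNgt; apply/negP => Hlt; move: E.
    by rewrite (nth_map false).
  move=> Hlt; rewrite nth_default // size_map; lia.
move=> j _; rewrite size_squares; split.
  exact: (helix_step Hhalt HB' HW).
exact: (helix_accepts Hhalt HB' HW Hout).
Qed.

Lemma reduction_sound x : all (satisfies x) (tableau_blocks gs N) ->
  exists2 y, size y <= L & tm_output (tm_run M T (pair_enc w y)) == [:: true].
Proof.
case/satisfies_tableau; rewrite size_squares => Hsq Hrun.
pose v k : Sym := (x (W - (B.+1 + size zw + k))).1.
(* The certificate is what the guess squares of the initial row hold up to the first blank. *)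
pose y := read_bits (mkseq v L).
have Hy : size y <= L by apply: leq_trans (size_read_bits _) _; rewrite size_mkseq.
have HW := helix_bound Hy; have Hhalt := HT Hy.
have HB' : T.+1 < B by lia.
have EW : W = B + (size zw + (L + B)) by rewrite size_zw.
have Hsq' i : i <= W -> square_ok x (W - i) (nth None gs i).
  by move=> Hi; have := Hsq i; rewrite ltnS subSS; apply.
have Hg k : k < L -> guess_ok (x (W - (B.+1 + size zw + k)))
    (x (W - (B.+1 + size zw + k)).+1).
  move=> Hk; have := Hsq' (B.+1 + size zw + k).
  rewrite nth_squares; last by rewrite EW; lia.
  have -> : (B.+1 + size zw + k < B) = false by lia.
  have -> : (B.+1 + size zw + k == B) = false by lia.
  have -> : B.+1 + size zw + k - B.+1 = size zw + k by lia.
  have -> : (size zw + k < size zw) = false by lia.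
  rewrite addKn Hk; apply; rewrite EW; lia.
have Hv k : nth None (map Some y) k = nth None (mkseq v L) k.
  apply: nth_read_bits => i; rewrite size_mkseq => Hi.
  rewrite !nth_mkseq //; last exact: ltnW.
  rewrite /v => E; have /andP [_ /implyP H] := Hg _ Hi.
  apply/eqP/H; rewrite -E; apply/eqP; congr (x _).1.
  by move: EW Hi; lia.
have Hx i : i <= W -> x (W - i) = start y i.
  move=> Hi; have := Hsq' i Hi; rewrite nth_squares //.
  case: ltnP => H1; first by move=> /eqP ->; rewrite start_blank.
  case: eqP => [->|H2]; first by move=> /eqP ->; rewrite start_start.
  case: ltnP => H3; first by move=> /eqP ->; rewrite start_word //; lia.
  rewrite start_guess //; last by lia.
  have Ei : i = B.+1 + size zw + (i - B.+1 - size zw) by lia.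
  case: ltnP => H4; rewrite Hv; last first.
    by move=> /eqP ->; rewrite nth_default // size_mkseq.
  move=> /andP [/eqP E _]; rewrite nth_mkseq // /v -Ei.
  by case: (x _) E => ? ? /= ->.
have Hx' := helix_unique Hhalt HB' HW Hx (fun j Hj => (Hrun j Hj).1).
exists y => //; apply: (helix_rejects Hhalt HB' HW HN) => j Hj.
rewrite -!Hx'; try lia.
exact: (Hrun j Hj).2.
Qed.

Lemma reduction_correct :
  MC_bowtie (reduction M cn K1 d1 K2 d2 w) <->
  exists y, size y <= L /\ tm_output (tm_run M T (pair_enc w y)) == [:: true].
Proof.
rewrite /reduction -/n -/N -/gs.
have Hsc : scoped [::] (tableau_blocks gs N).
  apply: scoped_tableau; first by rewrite size_squares /W; move: HB; move: (B) => B'; lia.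
  by rewrite /gs /squares -/n -/B; case: (B) HB.
split.
  by case/(MC_bowtie_csp (blank M) Hsc) => x /reduction_sound [y Hy H]; exists y.
move=> [y [Hy H]]; apply/(MC_bowtie_csp (blank M) Hsc).
exact: reduction_complete H.
Qed.
End Correctness.

(** * Choice of the polynomials *)

Theorem theorem1 : NP_hard MC_bowtie.
Proof.
move=> L' [V [[f [[M [c HM]] HV]] [cn HL]]].
(* [Z n] bounds the length of [pair_enc w y], so by time [T n] the verifier has halted on every
   admissible certificate; the tableau needs one time bound for all of them. *)
pose Z n := 2 * n + 2 + poly_bound cn n.
pose T n := poly_bound c (Z n).
have pc K : polynomial (fun=> K) := polynomial_const K.
have p2n : polynomial (fun n => 2 * n + 2).
  apply: polynomial_add (pc 2); exact: polynomial_mul (pc 2) polynomial_id.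
have pL : polynomial (poly_bound cn) := polynomial_poly_bound cn polynomial_id.
have pT : polynomial T.
  by apply: polynomial_poly_bound; apply: polynomial_add.
(* The margin 4 gives the strict inequality [T + 3 < B], by which the two blank margins also keep
   the rows long enough. *)
have [K1 [d1 HB]] := polynomial_add pT (pc 4).
pose W n := padding K1 d1 n + (2 * n + 2 + (poly_bound cn n + padding K1 d1 n)).
have pB : polynomial (padding K1 d1) by exists K1, d1.
have pW : polynomial W.
  apply: polynomial_add (pB) _; apply: polynomial_add (p2n) _.
  exact: polynomial_add.
have pN : polynomial (fun n => (T n).+2 * W n).
  apply: polynomial_mul pW; apply: polynomial_le (polynomial_add pT (pc 2)).
  by move=> n; rewrite addn2.
(* Rows 0 to [T.+1] take [T.+2 * W] entries, and the last of them is certain to be halted. *)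
have [K2 [d2 HN]] := pN.
exists (reduction M cn K1 d1 K2 d2); split; first exact: reduction_poly_computable.
move=> w.
have Hrun y : size y <= poly_bound cn (size w) ->
    tm_halt M (c_st (tm_run M (T (size w)) (pair_enc w y))) /\
    tm_output (tm_run M (T (size w)) (pair_enc w y)) = f (pair_enc w y).
  move=> Hy; have [t [Ht [Hh Ho]]] := HM (pair_enc w y).
  rewrite (tm_run_halted (t := t)) //.
  apply: leq_trans Ht _; apply: poly_bound_mono.
  by rewrite /pair_enc !size_cat size_double /= /Z; lia.
rewrite (reduction_correct (T := T (size w))); first last.
- by move=> y /Hrun [].
- exact: HN.
- by apply: leq_trans (HB (size w)); rewrite addn3 addn4.
rewrite HL; split=> -[y [Hy H]]; exists y; split=> //.
  by have [_ ->] := Hrun y Hy; apply/eqP/HV.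
by apply/HV; have [_ <-] := Hrun y Hy; apply/eqP.
Qed.
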